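(* Let $d\ge 0$ be an integer. Every simplicial $d$-sphere is $k$-complementary $(d-k)$-acyclic for every integer $k$ with $1\le k\le d+1$.
   Context: A simplicial $d$-sphere is a simplicial complex whose geometric realization is homeomorphic to $S^d$. A face of a regular CW complex $X$ (in particular of a simplicial complex) means a closed cell of $X$. For faces $\sigma_1,\ldots,\sigma_i$ of $X$, $X(\sigma_1,\ldots,\sigma_i)$ denotes the subcomplex of $X$ consisting of all faces that do not intersect any of $\sigma_1,\ldots,\sigma_i$ (for $i=0$ this is $X$ itself). A space $Y$ is $n$-acyclic (for $n\ge 0$) if it is non-empty and $\widetilde{H}_*(Y)=0$ for $*\le n$ (reduced integral homology); a space is $(-1)$-acyclic if it is non-empty. A regular CW complex $X$ is $k$-complementary $n$-acyclic if $X(\sigma_1,\ldots,\sigma_i)$ is $(n-\dim\sigma_1-\cdots-\dim\sigma_i)$-acyclic for all pairwise disjoint faces $\sigma_1,\ldots,\sigma_i$ of $X$ such that $\dim\sigma_1+\cdots+\dim\sigma_i\le n+1$ and $0\le i\le k$. *)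

(* Defs.v *)
From HB Require Import structures.
From mathcomp Require Import all_boot all_order all_algebra.
From mathcomp Require Import finmap.
From mathcomp.multinomials Require Import freeg.
From mathcomp Require Import all_classical all_reals all_analysis.
Import Order.TTheory GRing.Theory Num.Theory numFieldNormedType.Exports.

Set Implicit Arguments.
Unset Strict Implicit.
Unset Printing Implicit Defensive.

Local Open Scope classical_set_scope.
Local Open Scope ring_scope.

Definition homeomorphic (X Y : topologicalType) : Prop :=
  exists (f : X -> Y) (g : Y -> X),
    [/\ continuous f, continuous g, cancel f g & cancel g f].

(* The coercion of a set to a type carries the subspace topology. *)
Definition unit_sphere (R : realType) (d : nat) : set 'rV[R]_d.+1 :=
  [set x | \sum_(i < d.+1) x ord0 i ^+ 2 = 1].

Definition std_simplex (R : realType) (n : nat) : set 'rV[R]_n.+1 :=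
  [set t | (forall i, 0 <= t ord0 i) /\ \sum_(i < n.+1) t ord0 i = 1].

Arguments unit_sphere : clear implicits.
Arguments std_simplex : clear implicits.

Definition singular_simplex (R : realType) (X : topologicalType) (n : nat) :=
  continuousType (std_simplex R n) X.

Section Faces.
Variables (R : realType) (n : nat) (i : 'I_n.+2).

(* Inserts a zero coordinate in position i. *)
Definition coface_row (t : 'rV[R]_n.+1) : 'rV[R]_n.+2 :=
  \row_j (if unlift i j is Some k then t ord0 k else 0).

Lemma coface_row_continuous : continuous coface_row.
Proof.
move=> t A [B tB BA].
exists (fun a k => B a (fintype.lift i k)) => [a k|u uB].
  by have := tB ord0 (fintype.lift i k); rewrite mxE liftK (ord1 a).
apply: BA => a j; rewrite mxE; case: unliftP => [k ->|ji].
  by have := uB ord0 k; rewrite (ord1 a).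
have := tB a j; rewrite mxE ji unlift_none => /nbhs_singleton.
exact.
Qed.

Lemma coface_row_std_simplex (t : 'rV[R]_n.+1) :
  t \in std_simplex R n -> coface_row t \in std_simplex R n.+1.
Proof.
rewrite !inE => -[t0 t1]; split=> [j|].
  by rewrite mxE; case: unliftP.
rewrite (bigD1_ord i) //= mxE unlift_none add0r -[RHS]t1.
by apply: eq_bigr => k _; rewrite mxE liftK.
Qed.

Definition coface (t : std_simplex R n) : std_simplex R n.+1 :=
  exist _ (coface_row (val t)) (coface_row_std_simplex (valP t)).

Lemma coface_continuous : continuous coface.
Proof.
apply: continuous_comp_initial => t.
apply: (@continuous_comp _ _ _ (set_val : std_simplex R n -> 'rV[R]_n.+1)
  coface_row); last exact: coface_row_continuous.
exact: initial_continuous.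
Qed.

HB.instance Definition _ := isContinuous.Build _ _ coface coface_continuous.

Definition singular_face (X : topologicalType) (s : singular_simplex R X n.+1) :
    singular_simplex R X n := s \o coface.

End Faces.

Definition singular_chain (R : realType) (X : topologicalType) (n : nat) :=
  {freeg (singular_simplex R X n) / int}.

Definition boundary (R : realType) (X : topologicalType) (n : nat)
    (c : singular_chain R X n.+1) : singular_chain R X n :=
  fglift (fun s : singular_simplex R X n.+1 =>
    \sum_(i < n.+2) (-1) ^+ i *: << singular_face i s >>) c.

(* In degree 0 the differential of the augmented complex is the sum of the
   coefficients. *)
Definition reduced_cycle (R : realType) (X : topologicalType) (n : nat) :
    singular_chain R X n -> Prop :=
  if n is m.+1 then fun c => boundary c = 0 else fun c => deg c = 0.

(* The quotient of the reduced n-cycles by the n-boundaries is trivial. *)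
Definition reduced_homology_vanishes
    (R : realType) (X : topologicalType) (n : nat) : Prop :=
  forall c : singular_chain R X n, reduced_cycle c ->
    exists b : singular_chain R X n.+1, boundary b = c.

(* Meaningful for -1 <= n only; (-1)-acyclic just means non-empty. *)
Definition acyclic (R : realType) (n : int) (X : topologicalType) : Prop :=
  inhabited X /\
  forall j : nat, j%:Z <= n -> reduced_homology_vanishes R X j.

(* Possibly infinite; the elements of V need not all be vertices. *)
Record simplicial_complex (V : choiceType) : Type := SimplicialComplex {
  is_face :> {fset V} -> Prop;
  face_neq0 : forall s, is_face s -> s != fset0;
  face_sub : forall s t, is_face s -> (t `<=` s)%fset -> t != fset0 -> is_face t
}.

Definition face_dim (V : choiceType) (s : {fset V}) : nat := #|` s|.-1.

Definition closed_simplex (R : realType) (V : choiceType) (s : {fset V}) :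
    set {ptws V -> R} :=
  [set x | [/\ forall v, 0 <= x v, forall v, v \notin s -> x v = 0
             & \sum_(v <- s) x v = 1]].
Arguments closed_simplex : clear implicits.
Arguments closed_simplex R {V} s.

Record realization (R : realType) (V : choiceType) (K : simplicial_complex V) :
    Type := Realization {
  bary :> {ptws V -> R};
  bary_closed_simplex : exists2 s, K s & closed_simplex R s bary
}.

Section Realization.
Variables (R : realType) (V : choiceType) (K : simplicial_complex V).

HB.instance Definition _ := gen_eqMixin (realization R K).
HB.instance Definition _ := gen_choiceMixin (realization R K).

(* The weak topology: U is open when its trace on each closed simplex is open
   in the Euclidean topology of that simplex, which is the one induced by
   pointwise convergence of the barycentric coordinates. *)
Definition realization_open : set_system (realization R K) :=
  [set U | forall s, K s -> exists2 W : set {ptws V -> R}, open W &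
    forall x : realization R K, closed_simplex R s x -> (U x <-> W x)].

Lemma realization_openT : realization_open setT.
Proof. by move=> s _; exists setT; [exact: openT|]. Qed.

Lemma realization_openI : setI_closed realization_open.
Proof.
move=> A B oA oB s Ks.
have [WA oWA eA] := oA s Ks; have [WB oWB eB] := oB s Ks.
exists (WA `&` WB); first exact: openI.
move=> x sx; split=> -[Ax Bx]; split.
- exact/(eA x sx).
- exact/(eB x sx).
- exact/(eA x sx).
- exact/(eB x sx).
Qed.

Lemma realization_open_bigU (I : Type) (f : I -> set (realization R K)) :
  (forall i, realization_open (f i)) -> realization_open (\bigcup_i f i).
Proof.
move=> of_ s Ks.
have /(_ _)/cid2 H i := of_ i s Ks.
exists (\bigcup_i projT1 (H i)).
  by apply: bigcup_open => i _; case: (H i).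
move=> x sx; split=> -[i _ fx]; exists i => //; move: fx; case: (H i) => W /= _ e.
  by move/(e x sx).
by move/(e x sx).
Qed.

HB.instance Definition _ := isOpenTopological.Build (realization R K)
  realization_openT realization_openI realization_open_bigU.

End Realization.

Definition simplicial_sphere (R : realType) (d : nat) (V : choiceType)
    (K : simplicial_complex V) : Prop :=
  homeomorphic (realization R K) (unit_sphere R d).

Section Avoiding.
Variables (V : choiceType) (K : simplicial_complex V).
Variables (i : nat) (sigma : 'I_i -> {fset V}).

Definition is_avoiding_face (t : {fset V}) : Prop :=
  K t /\ forall a, [disjoint t & sigma a]%fset.

Lemma avoiding_face_neq0 t : is_avoiding_face t -> t != fset0.
Proof. by case=> /face_neq0. Qed.

Lemma avoiding_face_sub s t : is_avoiding_face s ->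
  (t `<=` s)%fset -> t != fset0 -> is_avoiding_face t.
Proof.
move=> [Ks ds] ts t0; split; first exact: face_sub ts t0.
by move=> a; apply: fdisjointWl ts (ds a).
Qed.

(* K(sigma_1, ..., sigma_i); closed simplices meet exactly when they share a
   vertex. *)
Definition avoiding : simplicial_complex V :=
  SimplicialComplex avoiding_face_neq0 avoiding_face_sub.

End Avoiding.

Definition complementary_acyclic (R : realType) (k : nat) (n : int)
    (V : choiceType) (K : simplicial_complex V) : Prop :=
  forall (i : nat) (sigma : 'I_i -> {fset V}),
    (i <= k)%N ->
    (forall a, K (sigma a)) ->
    (forall a b, a != b -> [disjoint sigma a & sigma b]%fset) ->
    (\sum_(a < i) face_dim (sigma a))%:Z <= n + 1 ->
    acyclic R (n - (\sum_(a < i) face_dim (sigma a))%:Z)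
      (realization R (avoiding K sigma)).

(* Main.v *)
(** Alexander duality is replaced by a Mayer-Vietoris argument.  Let W be the set
    of the vertices of sigma_1, ..., sigma_i, so that
    #|W| <= dim sigma_1 + ... + dim sigma_i + i, and for a vertex w let U_w be the
    open set of the points x of |K| whose coordinate x_w is not maximal among the
    coordinates of x.  Then |K(sigma_1, ..., sigma_i)| is a retract of the
    intersection of the U_w, w in W.  For a nonempty set S of vertices, the union
    of the U_w, w in S, is the complement of the points at which all the
    coordinates in S are maximal: it is |K| if S is not a face, and is otherwise
    dominated by |K| minus the center of S, which is a punctured sphere.  Hence
    all these unions have trivial reduced homology below degree d.  By
    Mayer-Vietoris, the intersection of U_1, ..., U_p, U is controlled, at the cost
    of one degree, by that of the p sets U_j `|` U; so an intersection of p of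
    these sets has trivial reduced homology in degrees at most d - p, and is
    nonempty if p <= d + 1.

    Singular homology is treated through formal chains of lists of points: the
    barycentric subdivision and the homotopies of the prism are both obtained by
    coning off a recursively defined chain from a centroid. *)

Require Import Defs.
From HB Require Import structures.
From mathcomp Require Import all_boot all_order all_algebra.
From mathcomp Require Import finmap.
From mathcomp.multinomials Require Import freeg.
From mathcomp Require Import all_classical all_reals all_analysis.
From mathcomp Require Import lra zify.
Import Order.TTheory GRing.Theory Num.Theory numFieldNormedType.Exports.

Set Implicit Arguments.
Unset Strict Implicit.
Unset Printing Implicit Defensive.

Local Open Scope classical_set_scope.
Local Open Scope ring_scope.

(** * Free abelian groups *)

(** The subcomplex that avoids a vertex is the complement of an open star, hence closed, whereas
    Mayer-Vietoris needs open sets. Nonmaximality of a coordinate is an open condition that still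
    allows the retraction: if no coordinate in W is maximal at x, then a maximal one, which is
    positive, lies outside W, so the coordinates in W can be set to zero and the others normalized.
    Geometry enters only through unions of the U_w, because these unions form a family that is
    closed under union; the rest is induction on the number of sets. Nonemptiness is the vanishing
    of reduced homology in degree -1, so the same induction yields it. With D the sum of the
    dimensions, p <= D + i <= D + k, hence d - p >= d - k - D, which is the required degree. The
    complex may be infinite a priori. Compactness of the sphere makes it finite, and then continuity
    into |K| can be tested on each barycentric coordinate. *)

Section FreeModule.
Variable K : choiceType.
Implicit Types (P Q : K -> Prop) (c d : {freeg K / int}).

HB.instance Definition _ (M : lmodType int) (f : K -> M) :=
  GRing.isZmodMorphism.Build {freeg K / int} M (fglift f) (lift_is_additive f).

Lemma fglift1 (M : lmodType int) (f : K -> M) x : fglift f << x >> = f x.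
Proof. by rewrite liftU scale1r. Qed.

Definition chain_on P c := forall x, x \in dom c -> P x.

Lemma chain_on0 P : chain_on P 0.
Proof. by move=> x; rewrite dom0. Qed.

Lemma chain_on1 P x : P x -> chain_on P << x >>.
Proof. by move=> Px y; rewrite domU1 inE => /eqP->. Qed.

Lemma chain_onD P c d : chain_on P c -> chain_on P d -> chain_on P (c + d).
Proof.
by move=> Pc Pd x /domD_subset; rewrite mem_cat => /orP[/Pc|/Pd].
Qed.

Lemma chain_onN P c : chain_on P c -> chain_on P (- c).
Proof. by move=> Pc x; rewrite domN => /Pc. Qed.

Lemma chain_onB P c d : chain_on P c -> chain_on P d -> chain_on P (c - d).
Proof. by move=> Pc Pd; apply: chain_onD Pc (chain_onN Pd). Qed.

Lemma chain_onZ P k c : chain_on P c -> chain_on P (k *: c).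
Proof. by move=> Pc x /domZ_subset/Pc. Qed.

Lemma chain_on_sum P (I : Type) (r : seq I) (p : pred I) F :
  (forall i, p i -> chain_on P (F i)) -> chain_on P (\sum_(i <- r | p i) F i).
Proof.
by move=> PF; elim/big_ind: _ => //; [exact: chain_on0|exact: chain_onD].
Qed.

Lemma chain_on_sub P Q c : (forall x, P x -> Q x) ->
  chain_on P c -> chain_on Q c.
Proof. by move=> PQ Pc x /Pc/PQ. Qed.

Lemma chain_onI P Q c : chain_on P c -> chain_on Q c ->
  chain_on (fun x => P x /\ Q x) c.
Proof. by move=> Pc Qc x xc; split; [exact: Pc|exact: Qc]. Qed.

(** Coefficients are integers, so every chain arises from its generators by differences. Closure
    under [c - d] covers sums and opposites at once and suits additive maps. *)
Lemma chain_ind P (Q : {freeg K / int} -> Prop) :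
  Q 0 -> (forall c d, Q c -> Q d -> Q (c - d)) -> (forall x, P x -> Q << x >>) ->
  forall c, chain_on P c -> Q c.
Proof.
move=> Q0 QB Q1 c Pc.
have QN d : Q d -> Q (- d) by move=> /(QB _ _ Q0); rewrite sub0r.
have QD d e : Q d -> Q e -> Q (d + e).
  by move=> Qd /QN Qe; rewrite -[e]opprK; apply: QB.
rewrite -[c]freeg_sumE big_seq; elim/big_ind: _ => // x /Pc Px.
have Qn n : Q (<< x >> *+ n).
  by elim: n => [|n IHn]; rewrite ?mulr0n // mulrS; apply: QD => //; apply: Q1.
have -> : << coeff x c *g x >> = << x >> *~ coeff x c by rewrite freegU_mulz intz.
by case: (coeff x c) => n; [exact: Qn|exact/QN/Qn].
Qed.

Lemma eq_fglift P (M : lmodType int) (f g : K -> M) c :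
  chain_on P c -> (forall x, P x -> f x = g x) -> fglift f c = fglift g c.
Proof.
move=> Pc fg; move: c Pc; apply: chain_ind => [|c d|x Px].
- by rewrite !raddf0.
- by rewrite !raddfB /= => -> ->.
- by rewrite !fglift1 fg.
Qed.

Lemma fglift_add (M : lmodType int) (f g : K -> M) c :
  fglift (fun x => f x + g x) c = fglift f c + fglift g c.
Proof.
have : chain_on (fun=> True) c by [].
move: c; apply: chain_ind => [|c d|x _].
- by rewrite !raddf0 addr0.
- by rewrite !raddfB /= => -> -> ; rewrite opprD addrACA.
- by rewrite !fglift1.
Qed.

Lemma fglift_opp (M : lmodType int) (f : K -> M) c :
  fglift (fun x => - f x) c = - fglift f c.
Proof.
have : chain_on (fun=> True) c by [].
move: c; apply: chain_ind => [|c d|x _].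
- by rewrite !raddf0.
- by rewrite !raddfB /= => -> ->.
- by rewrite !fglift1.
Qed.

Lemma fglift_id c : fglift (fun x => << x >>) c = c.
Proof.
have : chain_on (fun=> True) c by [].
move: c; apply: chain_ind => [|c d|x _].
- by rewrite raddf0.
- by rewrite !raddfB /= => -> ->.
- by rewrite fglift1.
Qed.

End FreeModule.

Lemma chain_on_fglift (K K' : choiceType) P Q (f : K -> {freeg K' / int}) c :
  chain_on P c -> (forall x, P x -> chain_on Q (f x)) ->
  chain_on Q (fglift f c).
Proof.
move=> Pc PQ; move: c Pc; apply: chain_ind => [|c d Qc Qd|x Px].
- by rewrite raddf0; apply: chain_on0.
- by rewrite raddfB; apply: chain_onB.
- by rewrite fglift1; apply: PQ.
Qed.

Lemma raddf_fglift (K : choiceType) (M N : lmodType int) (f : K -> M)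
  (h : {additive M -> N}) c : h (fglift f c) = fglift (fun x => h (f x)) c.
Proof.
have : chain_on (fun=> True) c by [].
move: c; apply: chain_ind => [|c d|x _].
- by rewrite !raddf0.
- by rewrite !raddfB /= => -> ->.
- by rewrite !fglift1.
Qed.

(** * The augmented complex of lists of points *)

Definition del (T : Type) i (l : seq T) := take i l ++ drop i.+1 l.

Section ListComplex.
Variable E : choiceType.
Implicit Types (x : E) (l : seq E) (c : {freeg (seq E) / int}).

Definition cone x c : {freeg (seq E) / int} := fglift (fun l => << x :: l >>) c.
HB.instance Definition _ x := GRing.Additive.copy (cone x) (fglift (fun l => << x :: l >>)).

Lemma cone1 x l : cone x << l >> = << x :: l >>.
Proof. exact: fglift1. Qed.

(** The recursive form makes coning formal. The boundary of [[:: x]] is the empty list, so the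
    augmentation is built in; [list_bdE] recovers the alternating sum. *)
Fixpoint list_bd l : {freeg (seq E) / int} :=
  if l is x :: l' then << l' >> - cone x (list_bd l') else 0.

Definition lbd c : {freeg (seq E) / int} := fglift list_bd c.
HB.instance Definition _ := GRing.Additive.copy lbd (fglift list_bd).

Lemma lbd1 l : lbd << l >> = list_bd l.
Proof. exact: fglift1. Qed.

(** [cone x] is a contracting homotopy of the augmented complex: it fills every cycle. *)
Lemma lbd_cone x c : lbd (cone x c) = c - cone x (lbd c).
Proof.
have : chain_on (fun=> True) c by [].
move: c; apply: chain_ind => [|c d|l _].
- by rewrite !raddf0 addr0.
- by rewrite !raddfB /= => -> ->; rewrite !opprD addrACA.
- by rewrite cone1 !lbd1.
Qed.

Lemma lbd_list_bd l : lbd (list_bd l) = 0.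
Proof.
elim: l => [|x l IHl] /=; first by rewrite raddf0.
by rewrite raddfB /= lbd_cone lbd1 IHl raddf0 subr0 subrr.
Qed.

Lemma list_bdE l : list_bd l = \sum_(i < size l) (-1) ^+ i *: << del i l >>.
Proof.
elim: l => [|x l IHl] /=; first by rewrite big_ord0.
rewrite big_ord_recl expr0 scale1r /del /= drop0; congr (_ + _).
rewrite IHl raddf_sum -sumrN; apply: eq_bigr => i _.
by rewrite raddfZsign /= cone1 -scaleN1r scalerA -exprS.
Qed.

Definition slist (C : E -> Prop) n l := size l = n /\ {in l, forall x, C x}.

Lemma chain_on_cone (C : E -> Prop) n x c : C x ->
  chain_on (slist C n) c -> chain_on (slist C n.+1) (cone x c).
Proof.
move=> Cx /chain_on_fglift; apply=> l [ln lC]; apply: chain_on1.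
by split=> [|y]; rewrite /= ?ln // inE => /orP[/eqP->|/lC].
Qed.

Lemma chain_on_list_bd (C : E -> Prop) n l :
  slist C n l -> chain_on (slist C n.-1) (list_bd l).
Proof.
move=> [<-]; elim: {n} l => [|x l IHl] /= lC; first exact: chain_on0.
have lC' : {in l, forall x, C x} by move=> y yl; apply: lC; rewrite inE yl orbT.
apply: chain_onB; first exact: chain_on1.
case: l lC lC' IHl => [_ _ _|y l lC lC' IHl] /=.
  by rewrite raddf0; apply: chain_on0.
by apply: chain_on_cone; [apply: lC; rewrite mem_head|exact: IHl].
Qed.

Variable beta : seq E -> E.

(** The argument [n] is the expected length of [l]; the recursion passes through the chain
    [list_bd l], so it cannot be structural on the list. *)
Fixpoint subdiv n l : {freeg (seq E) / int} :=
  if n is m.+1 then cone (beta l) (fglift (subdiv m) (list_bd l)) else << l >>.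

(* Coning off bounds the cycle [D l - H (bd l)], so that bd H + H bd = D if [D] is
   a chain map which vanishes on the empty list. *)
Fixpoint cone_htpy (D : nat -> seq E -> {freeg (seq E) / int}) n l :=
  if n is m.+1
  then cone (beta l) (D m.+1 l - fglift (cone_htpy D m) (list_bd l))
  else 0.

Variable C : E -> Prop.
Hypothesis beta_in : forall n l, slist C n.+1 l -> C (beta l).

Lemma chain_on_subdiv n l : slist C n l -> chain_on (slist C n) (subdiv n l).
Proof.
elim: n l => [|n IHn] l lC /=; first exact: chain_on1.
apply: chain_on_cone; first exact: beta_in lC.
by apply: chain_on_fglift; [exact: chain_on_list_bd lC|exact: IHn].
Qed.

Lemma chain_on_cone_htpy D n l :
  (forall n l, slist C n l -> chain_on (slist C n) (D n l)) ->
  slist C n l -> chain_on (slist C n.+1) (cone_htpy D n l).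
Proof.
move=> DC; elim: n l => [|n IHn] l lC /=; first exact: chain_on0.
apply: chain_on_cone; first exact: beta_in lC.
apply: chain_onB; first exact: DC.
by apply: chain_on_fglift; [exact: chain_on_list_bd lC|exact: IHn].
Qed.

End ListComplex.

Section ChainMaps.
Variables (E : choiceType) (beta : seq E -> E).
Implicit Types (x : E) (l : seq E) (c : {freeg (seq E) / int}).

Notation sized := (slist (fun _ : E => True)).

Lemma sizedE n l : sized n l <-> size l = n.
Proof. by split=> [[]|ln] //; split. Qed.

(* [D] is a chain map of the augmented complex, degree [n] being spanned by the
   lists with [n] elements. *)
Definition list_chain_map (D : nat -> seq E -> {freeg (seq E) / int}) :=
  (forall l, size l = 0%N -> lbd (D 0 l) = 0) /\
  (forall n l, size l = n.+1 -> lbd (D n.+1 l) = fglift (D n) (list_bd l)).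

Lemma list_chain_mapE D n c : list_chain_map D ->
  chain_on (sized n) c -> lbd (fglift (D n) c) = fglift (D n.-1) (lbd c).
Proof.
move=> [D0 DS]; move: c; apply: chain_ind => [|c d|l /sizedE ln].
- by rewrite !raddf0.
- by rewrite !raddfB /= => -> ->.
rewrite fglift1 lbd1; case: n ln => [/[dup]/size0nil -> l0|n ln].
  by rewrite D0 // raddf0.
exact: DS.
Qed.

Lemma list_bd_sized n l : size l = n -> chain_on (sized n.-1) (list_bd l).
Proof. by move=> ln; apply: chain_on_list_bd; apply/sizedE. Qed.

Lemma list_chain_map_id : list_chain_map (fun _ l => << l >>).
Proof.
by split=> [l /size0nil->|n l _]; rewrite lbd1 ?fglift_id.
Qed.

Lemma subdiv_list_chain_map : list_chain_map (subdiv beta).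
Proof.
split=> [l /size0nil->|]; first by rewrite lbd1.
elim=> [|n IHn] l ln /=; rewrite lbd_cone.
  case: l ln => [//|x [|//]] _ /=; rewrite raddf0 subr0 fglift1 /=.
  by rewrite lbd1 raddf0 subr0.
(* The subdivided boundary is a cycle: by the induction hypothesis its boundary is the subdivision
   of [lbd (list_bd l)], which is zero. *)
suff -> : lbd (fglift (fun l => cone (beta l) (fglift (subdiv beta n) (list_bd l)))
   (list_bd l)) = 0 by rewrite raddf0 subr0.
rewrite [LHS]raddf_fglift -[RHS](raddf0 (fglift (subdiv beta n))) -(lbd_list_bd l).
rewrite [in RHS]raddf_fglift; apply: (eq_fglift (list_bd_sized ln)) => l' /sizedE.
exact: IHn.
Qed.

Lemma cone_htpyE D n l : list_chain_map D -> D 0%N [::] = 0 -> size l = n ->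
  lbd (cone_htpy beta D n l) = D n l - fglift (cone_htpy beta D n.-1) (list_bd l).
Proof.
move=> DD D0; elim: n l => [|n IHn] l ln.
  by rewrite (size0nil ln) D0 /= !raddf0 addr0.
rewrite /= lbd_cone; set c := D n.+1 l - _; suff -> : lbd c = 0 by rewrite raddf0 subr0.
have [_ DS] := DD.
rewrite raddfB /= DS // [X in _ - X]raddf_fglift.
rewrite (eq_fglift (list_bd_sized ln) (f := fun l => lbd (cone_htpy beta D n l))
  (g := fun l => D n l - fglift (cone_htpy beta D n.-1) (list_bd l))); last first.
  by move=> l' /sizedE; apply: IHn.
rewrite fglift_add fglift_opp opprD addrA subrr sub0r opprK.
transitivity (fglift (cone_htpy beta D n.-1) (lbd (list_bd l))).
  by rewrite [RHS]raddf_fglift.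
by rewrite lbd_list_bd raddf0.
Qed.

End ChainMaps.

Section Naturality.
Variables (E E' : choiceType) (f : E -> E').
Variables (beta : seq E -> E) (beta' : seq E' -> E').
Hypothesis f_beta : forall l, f (beta l) = beta' (map f l).
Implicit Types (l : seq E) (c : {freeg (seq E) / int}).

Definition push c : {freeg (seq E') / int} := fglift (fun l => << map f l >>) c.
HB.instance Definition _ := GRing.Additive.copy push (fglift (fun l => << map f l >>)).

Lemma push_cone x c : push (cone x c) = cone (f x) (push c).
Proof.
rewrite /push /cone ![LHS]raddf_fglift [RHS]raddf_fglift.
by apply: (@eq_fglift _ (fun=> True)) => // l _; rewrite /= !fglift1.
Qed.

Lemma push_list_bd l : push (list_bd l) = list_bd (map f l).
Proof.
elim: l => [|x l IHl]; rewrite ?raddf0 //= raddfB /= push_cone IHl.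
by rewrite [push _]fglift1.
Qed.

(** Applied to the inclusions of the faces of a prism, this is what lets an operator on lists
    descend to singular simplices compatibly with their faces. *)
Definition list_natural (D : nat -> seq E -> _) D' :=
  forall n l, push (D n l) = D' n (map f l) :> {freeg (seq E') / int}.

Lemma push_fglift (D : nat -> seq E -> _) D' n l :
  (forall l, push (D n l) = D' n (map f l) :> {freeg (seq E') / int}) ->
  push (fglift (D n) (list_bd l)) = fglift (D' n) (list_bd (map f l)).
Proof.
move=> DD'; rewrite -push_list_bd [LHS]raddf_fglift [RHS]raddf_fglift.
by apply: (@eq_fglift _ (fun=> True)) => // l' _; rewrite /= fglift1.
Qed.

Lemma subdiv_natural : list_natural (subdiv beta) (subdiv beta').
Proof.
elim=> [|n IHn] l /=; first exact: fglift1.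
by rewrite push_cone f_beta (push_fglift _ IHn).
Qed.

Lemma cone_htpy_natural D D' : list_natural D D' ->
  list_natural (cone_htpy beta D) (cone_htpy beta' D').
Proof.
move=> DD'; elim=> [|n IHn] l /=; first by rewrite raddf0.
by rewrite push_cone raddfB /= f_beta DD' (push_fglift _ IHn).
Qed.

End Naturality.

(** * Augmented singular chains *)

Section AugmentedChains.
Variables (R : realType) (X : topologicalType).

(* Degrees are shifted by one: [tt] is the empty simplex, which spans the degree
   -1 part of the augmented complex. *)
Definition asimplex (m : nat) : choiceType :=
  if m is n.+1 then singular_simplex R X n else unit.

Definition achain m := {freeg (asimplex m) / int}.

Definition aface m : 'I_m -> asimplex m -> asimplex m.-1 :=
  match m with
  | 0 => fun _ => id
  | 1 => fun _ _ => tt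
  | n.+2 => fun i s => singular_face i s
  end.

Definition bd_simplex m (s : asimplex m) : achain m.-1 :=
  \sum_(i < m) (-1) ^+ i *: << aface i s >>.

Definition bd m (c : achain m) : achain m.-1 := fglift (@bd_simplex m) c.
HB.instance Definition _ m := GRing.Additive.copy (@bd m) (fglift (@bd_simplex m)).

Lemma bd1 m (s : asimplex m) : bd << s >> = bd_simplex s.
Proof. exact: fglift1. Qed.

Definition simplex_in (A : set X) m : asimplex m -> Prop :=
  if m is n.+1 then fun s : singular_simplex R X n => forall t, A (s t)
  else fun=> True.

Lemma std_simplex_vertex n : delta_mx ord0 ord0 \in std_simplex R n.
Proof.
rewrite inE; split=> [i|]; first by rewrite mxE ler0n.
rewrite (bigD1 ord0) //= mxE !eqxx big1 ?addr0 // => i i0.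
by rewrite mxE (negbTE i0) andbF.
Qed.

Definition vertex0 n : std_simplex R n :=
  exist (fun x => x \in std_simplex R n) _ (std_simplex_vertex n).

(* A junk constant simplex if [h] is not continuous. *)
Definition mk_simplex n (h : std_simplex R n -> X) : singular_simplex R X n :=
  match pselect (continuous h) with
  | left ch => mkcts ch
  | right _ => cst (h (vertex0 n))
  end.

Lemma mk_simplexE n (h : std_simplex R n -> X) : continuous h ->
  mk_simplex h =1 h.
Proof. by rewrite /mk_simplex; case: pselect. Qed.

End AugmentedChains.


(** * Pointwise operations on continuous functions *)

Section ContinuousOps.
Variables (R : realType) (T : topologicalType).

Lemma cont_cst (Y : topologicalType) (y : Y) : continuous (fun _ : T => y).
Proof. by move=> x; exact: cvg_cst. Qed.

Lemma cont_comp (Y Z : topologicalType) (f : T -> Y) (g : Y -> Z) :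
  continuous f -> continuous g -> continuous (fun x => g (f x)).
Proof. by move=> cf cg x; apply: continuous_comp; [exact: cf|exact: cg]. Qed.

Lemma cont_pair (Y Z : topologicalType) (f : T -> Y) (g : T -> Z) :
  continuous f -> continuous g -> continuous (fun x => (f x, g x)).
Proof. by move=> cf cg x; apply: cvg_pair; [exact: cf|exact: cg]. Qed.

Lemma cont_fst (Y Z : topologicalType) (f : T -> Y * Z) :
  continuous f -> continuous (fun x => (f x).1).
Proof. by move=> cf; apply: cont_comp cf _ => -[y z]; exact: cvg_fst. Qed.

Lemma cont_snd (Y Z : topologicalType) (f : T -> Y * Z) :
  continuous f -> continuous (fun x => (f x).2).
Proof. by move=> cf; apply: cont_comp cf _ => -[y z]; exact: cvg_snd. Qed.

Lemma contD (V : normedModType R) (f g : T -> V) :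
  continuous f -> continuous g -> continuous (fun x => f x + g x).
Proof. by move=> cf cg x; apply: cvgD; [exact: cf|exact: cg]. Qed.

Lemma contN (V : normedModType R) (f : T -> V) :
  continuous f -> continuous (fun x => - f x).
Proof. by move=> cf x; apply: cvgN; exact: cf. Qed.

Lemma contB (V : normedModType R) (f g : T -> V) :
  continuous f -> continuous g -> continuous (fun x => f x - g x).
Proof. by move=> cf cg; apply: contD => //; apply: contN. Qed.

Lemma contZ (V : normedModType R) (k : T -> R) (f : T -> V) :
  continuous k -> continuous f -> continuous (fun x => k x *: f x).
Proof. by move=> ck cf x; apply: cvgZ; [exact: ck|exact: cf]. Qed.

Lemma contM (f g : T -> R) :
  continuous f -> continuous g -> continuous (fun x => f x * g x).
Proof. by move=> cf cg x; apply: cvgM; [exact: cf|exact: cg]. Qed.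

Lemma contV (f : T -> R) :
  continuous f -> (forall x, f x != 0) -> continuous (fun x => (f x)^-1).
Proof. by move=> cf f0 x; apply: cvgV; [exact: f0|exact: cf]. Qed.

Lemma cont_norm (V : normedModType R) (f : T -> V) :
  continuous f -> continuous (fun x => `|f x|).
Proof. by move=> cf; apply: cont_comp cf (@norm_continuous _ _). Qed.

Lemma cont_sum (V : normedModType R) (I : Type) (r : seq I) (p : pred I)
    (F : I -> T -> V) :
  (forall i, continuous (F i)) -> continuous (fun x => \sum_(i <- r | p i) F i x).
Proof.
move=> cF; elim: r => [|i r IHr].
  rewrite (_ : (fun _ => _) = cst 0); first exact: cont_cst.
  by apply/funext => x; rewrite big_nil.
case pi : (p i).
  rewrite (_ : (fun _ => _) = fun x => F i x + \sum_(j <- r | p j) F j x); first exact: contD.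
  by apply/funext => x; rewrite big_cons pi.
by rewrite (_ : (fun _ => _) = fun x => \sum_(j <- r | p j) F j x) //;
  apply/funext => x; rewrite big_cons pi.
Qed.

Lemma cont_coord m n (f : T -> 'M[R]_(m.+1, n.+1)) i j :
  continuous f -> continuous (fun x => f x i j).
Proof.
move=> cf; apply: (cont_comp (g := fun M : 'M[R]_(m.+1, n.+1) => M i j) cf).
exact: coord_continuous.
Qed.

Lemma cont_val (Y : topologicalType) (A : set Y) (f : T -> A) :
  continuous f -> continuous (fun x => val (f x)).
Proof. by move=> cf; apply: cont_comp cf _; exact: initial_continuous. Qed.

End ContinuousOps.

(** * Singular simplices spanned by lists of points *)

Section Realize.
Variables (R : realType) (E : normedModType R) (Y : topologicalType).
Implicit Types (G : E -> Y) (C : set E) (w : seq E).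

Definition comb n (t : 'rV[R]_n.+1) w : E := \sum_(i < n.+1) t ord0 i *: w`_i.

(** Convexity of [C]. *)
Definition comb_closed C := forall n (t : std_simplex R n) w,
  slist C n.+1 w -> C (comb (val t) w).

Lemma comb_continuous n w : continuous (fun t : std_simplex R n => comb (val t) w).
Proof.
apply: cont_sum => i; apply: contZ; last exact: cont_cst.
by apply: cont_coord; apply: cont_val => t.
Qed.

Lemma comb_coface n (i : 'I_n.+2) (t : 'rV[R]_n.+1) w : size w = n.+2 ->
  comb (coface_row i t) w = comb t (del i w).
Proof.
move=> sw; rewrite /comb (bigD1_ord i) //= mxE unlift_none scale0r add0r.
apply: eq_bigr => k _; rewrite mxE liftK; congr (_ *: _).
have iw : (i <= size w)%N by rewrite sw ltnW.
rewrite /del nth_cat size_takel //= /bump.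
have [ki|ik] := ltnP k i; first by rewrite add0n nth_take.
by rewrite nth_drop addSn subnKC.
Qed.

(* Stands in for continuity within the subset. *)
Definition simplexwise_continuous (S : topologicalType) (A : set S) (f : S -> Y) :=
  forall n (h : std_simplex R n -> S), continuous h -> (forall t, A (h t)) ->
  continuous (fun t => f (h t)).

Definition realize m G w : asimplex R Y m :=
  match m with
  | 0 => tt
  | n.+1 => mk_simplex (fun t : std_simplex R n => G (comb (val t) w))
  end.

Variables (C : set E) (G : E -> Y).
Hypotheses (C_comb : comb_closed C) (cG : simplexwise_continuous C G).

Lemma realizeE n w (t : std_simplex R n) : slist C n.+1 w ->
  (realize n.+1 G w : singular_simplex R Y n) t = G (comb (val t) w).
Proof.
move=> wC; apply: mk_simplexE; apply: cG; first exact: comb_continuous.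
by move=> ?; apply: C_comb.
Qed.

Lemma realize_in (B : set Y) m w : (forall x, C x -> B (G x)) ->
  slist C m w -> simplex_in B (realize m G w).
Proof. by case: m => // n CB wC t; rewrite realizeE //; apply/CB/C_comb. Qed.

Lemma slist_del (m : nat) (i : 'I_m) w : slist C m w -> slist C m.-1 (del i w).
Proof.
case: m i => [[//]|m] i [sw wC]; split.
  rewrite /del size_cat size_takel ?sw 1?ltnW // size_drop sw subSS subnKC //.
  by rewrite -ltnS.
move=> x; rewrite /del mem_cat => /orP[/mem_take|/mem_drop]; exact: wC.
Qed.

Lemma aface_realize m (i : 'I_m) w : slist C m w ->
  aface i (realize m G w) = realize m.-1 G (del i w).
Proof.
case: m i => [[//]|[//|n]] i wC; apply/continuousEP => t.
rewrite [RHS]realizeE; last exact: slist_del wC.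
by case: (wC) => sw _; rewrite -comb_coface //; exact: (realizeE (coface i t) wC).
Qed.

(** Realization is a chain map, so identities between chains of lists become identities between
    singular chains. *)
Lemma bd_realize m (c : {freeg (seq E) / int}) : chain_on (slist C m) c ->
  bd (fglift (fun w => << realize m G w >>) c : achain R Y m) =
  fglift (fun w => << realize m.-1 G w >>) (lbd c).
Proof.
move: c; apply: chain_ind => [|c d|w wC].
- by rewrite !raddf0.
- by rewrite !raddfB /= => -> ->.
rewrite !fglift1 lbd1 bd1 list_bdE raddf_sum.
case: (wC) => -> _; apply: eq_bigr => i _.
by rewrite raddfZsign /= fglift1 aface_realize.
Qed.

End Realize.

(** * Operators on singular chains induced by operators on lists *)

Section Del.

Lemma size_del (T : Type) (s : seq T) i : (i < size s)%N -> size (del i s) = (size s).-1.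
Proof.
move=> lis; rewrite /del size_cat size_takel 1?ltnW // size_drop.
by case: (size s) lis => // n; rewrite ltnS subSS => /subnKC->.
Qed.

Lemma nth_del (T : Type) (x0 : T) (s : seq T) i j : (i < size s)%N ->
  nth x0 (del i s) j = nth x0 s (bump i j).
Proof.
move=> lis; rewrite /del nth_cat size_takel ?(ltnW lis) // /bump.
have [ji|ij] := ltnP j i; first by rewrite add0n nth_take.
by rewrite nth_drop addSn subnKC.
Qed.

Lemma del_map (S T : Type) (f : S -> T) i s : del i (map f s) = map f (del i s).
Proof. by rewrite /del map_cat map_take map_drop. Qed.

Lemma del_enum n (i : 'I_n.+1) : del i (enum 'I_n.+1) = map (fintype.lift i) (enum 'I_n).
Proof.
apply: (inj_map val_inj); rewrite -del_map val_enum_ord -map_comp.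
rewrite (eq_map (g := bump i \o val)) // map_comp val_enum_ord.
have iS : (i < size (iota 0 n.+1))%N by rewrite size_iota.
apply: (@eq_from_nth _ 0%N) => [|j].
  by rewrite size_del // size_map !size_iota.
rewrite size_del // size_iota /= => jn.
rewrite nth_del // (nth_map 0%N) ?size_iota // !nth_iota ?add0n //.
rewrite -[_ :: _]/(iota 0 n.+1) nth_iota ?add0n //; exact: ltn_ord (fintype.lift i (Ordinal jn)).
Qed.

End Del.

Definition centroid (R : realType) (E : lmodType R) (l : seq E) : E :=
  (size l)%:R^-1 *: \sum_(x <- l) x.

Lemma centroid_map (R : realType) (E E' : lmodType R) (f : {linear E -> E'}) l :
  f (centroid l) = centroid (map f l).
Proof. by rewrite /centroid linearZ linear_sum big_map size_map. Qed.

Lemma comb_map (R : realType) (E E' : normedModType R) (f : {linear E -> E'}) n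
  (t : 'rV[R]_n.+1) l : comb t (map f l) = f (comb t l).
Proof.
rewrite /comb linear_sum; apply: eq_bigr => i _; rewrite linearZ_LR /=.
have [il|li] := ltnP i (size l); first by rewrite (nth_map 0).
by rewrite !nth_default ?size_map // (raddf0 f).
Qed.

Section BarycenterIn.
Variables (R : realType) (E : normedModType R) (C : set E).
Hypothesis C_comb : comb_closed C.

Lemma centroid_in n l : slist C n.+1 l -> C (centroid l).
Proof.
move=> lC; have [sl _] := lC.
have tP : const_mx n.+1%:R^-1 \in std_simplex R n.
  rewrite inE; split=> [i|]; first by rewrite mxE invr_ge0 ler0n.
  under eq_bigr do rewrite mxE.
  by rewrite sumr_const card_ord -[_ *+ _]mulr_natr mulVf ?pnatr_eq0.
pose t : std_simplex R n := exist (fun x => x \in std_simplex R n) _ tP.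
suff -> : centroid l = comb (val t) l by exact: C_comb.
rewrite /centroid /comb sl (big_nth 0) big_mkord sl scaler_sumr.
by apply: eq_bigr => i _; rewrite mxE.
Qed.

End BarycenterIn.

(** * The prism over a standard simplex *)

Section Prism.
Variable R : realType.

(* The second component is the time of a homotopy. *)
Definition prism_space n : normedModType R := ('rV[R]_n.+1 * R)%type.

Definition prism n : set (prism_space n) :=
  [set p | std_simplex R n p.1 /\ 0 <= p.2 <= 1].

(** The universal simplex, at time 0: a natural operator on lists acts on singular simplices through
    its value at [verts n]. *)
Definition verts n : seq (prism_space n) :=
  [seq (delta_mx ord0 i, 0) | i <- enum 'I_n.+1].

Definition prism_face n (i : 'I_n.+2) (p : prism_space n) : prism_space n.+1 :=
  (coface_row i p.1, p.2).

Lemma prism_face_linear n (i : 'I_n.+2) : linear (prism_face i).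
Proof.
move=> k [x a] [y b]; rewrite /prism_face /=; congr (_, _).
by apply/rowP => j; rewrite !mxE; case: unliftP => [u _|_]; rewrite ?mxE ?mulr0 ?addr0.
Qed.

HB.instance Definition _ n (i : 'I_n.+2) :=
  GRing.isLinear.Build R (prism_space n) (prism_space n.+1) _ (prism_face i)
    (prism_face_linear i).

Lemma comb_fst n m (t : 'rV[R]_m.+1) (l : seq (prism_space n)) j :
  (comb t l).1 ord0 j = \sum_(i < m.+1) t ord0 i * (l`_i).1 ord0 j.
Proof.
rewrite /comb; elim/big_ind2: _ => [|x a y b <- <-|i _]; rewrite ?mxE //.
Qed.

Lemma comb_snd n m (t : 'rV[R]_m.+1) (l : seq (prism_space n)) :
  (comb t l).2 = \sum_(i < m.+1) t ord0 i * (l`_i).2.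
Proof. by rewrite /comb; elim/big_ind2: _ => [//|x a y b <- <-|i _]. Qed.

Lemma comb_closed_prism n : comb_closed (@prism n).
Proof.
move=> m [t tP] l [sl lP] /=; move: (tP); rewrite inE => -[t0 t1].
have lPi (i : 'I_m.+1) : prism l`_i by apply/lP/mem_nth; rewrite sl.
split; first split.
- by move=> j; rewrite comb_fst sumr_ge0 // => i _; rewrite mulr_ge0 //; case: (lPi i) => -[].
- under eq_bigr do rewrite comb_fst.
  rewrite exchange_big /= -[RHS]t1; apply: eq_bigr => i _.
  by rewrite -mulr_sumr; case: (lPi i) => -[_ ->]; rewrite mulr1.
rewrite comb_snd; apply/andP; split.
  by apply: sumr_ge0 => i _; rewrite mulr_ge0 //; case: (lPi i) => _ /andP[].
rewrite -t1; apply: ler_sum => i _; rewrite ler_piMr //.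
by case: (lPi i) => _ /andP[].
Qed.

Lemma verts_prism n : slist (@prism n) n.+1 (verts n).
Proof.
split=> [|p /mapP[i _ ->]]; first by rewrite size_map size_enum_ord.
split; last by rewrite lexx ler01.
split=> [j|]; first by rewrite mxE ler0n.
rewrite (bigD1 i) //= mxE !eqxx big1 ?addr0 // => j ji.
by rewrite mxE (negbTE ji) andbF.
Qed.

Lemma del_verts n (i : 'I_n.+2) : del i (verts n.+1) = map (prism_face i) (verts n).
Proof.
rewrite del_map del_enum /verts -!map_comp; apply: eq_map => k.
rewrite /= /prism_face /=; congr (_, _); apply/rowP => j; rewrite !mxE.
case: unliftP => [u ->|->]; last by rewrite (negbTE (neq_lift _ _)) andbF.
by rewrite mxE (inj_eq (@lift_inj _ _)).
Qed.

Lemma comb_verts n (t : 'rV[R]_n.+1) : comb t (verts n) = (t, 0).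
Proof.
have vE (i : 'I_n.+1) : (verts n)`_i = (delta_mx ord0 i, 0).
  by rewrite (nth_map i) ?size_enum_ord // nth_ord_enum.
apply/eqP; rewrite -pair_eqE; apply/andP; split; apply/eqP; last first.
  by rewrite comb_snd big1 // => i _; rewrite vE mulr0.
apply/rowP => j; rewrite comb_fst (bigD1 j) //= vE mxE !eqxx mulr1.
rewrite big1 ?addr0 // => i ij; rewrite vE mxE [j == i]eq_sym (negbTE ij) andbF.
by rewrite mulr0.
Qed.

End Prism.

Section Extension.
Variables (R : realType) (X : topologicalType) (n : nat).
Implicit Type s : singular_simplex R X n.

(** Points off the simplex get the value of [s] at [vertex0], so [s] can be composed with maps into
    the row space without leaving its image. *)
Definition extend s (x : 'rV[R]_n.+1) : X := s (insubd (vertex0 R n) x).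

Lemma extend_val s (t : std_simplex R n) : extend s (val t) = s t.
Proof. by rewrite /extend valKd. Qed.

Lemma extend_in (A : set X) s : (forall t, A (s t)) -> forall x, A (extend s x).
Proof. by move=> sA x; apply: sA. Qed.

Lemma extend_continuous s : simplexwise_continuous R (std_simplex R n) (extend s).
Proof.
move=> m h ch hP; apply: (@cont_comp _ _ _
  (fun t => insubd (vertex0 R n) (h t) : std_simplex R n) s); last first.
  exact: cts_fun.
apply: continuous_comp_initial.
rewrite (_ : _ \o _ = h) //; apply/funext => t /=.
by rewrite set_valE [LHS]insubdK // inE; exact: hP.
Qed.

End Extension.

Lemma extend_face (R : realType) (X : topologicalType) n (i : 'I_n.+2)
    (s : singular_simplex R X n.+1) x : std_simplex R n x ->
  extend (singular_face i s) x = extend s (coface_row i x).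
Proof.
move=> /mem_set xP.
by have := extend_val (singular_face i s) (exist _ x xP) => /= ->; rewrite -extend_val.
Qed.

Section Operators.
Variables (R : realType) (X Y : topologicalType).
Variables (A : set X) (B : set Y) (F : X * R -> Y).

Definition cylinder (A : set X) : set (X * R) := [set p | A p.1 /\ 0 <= p.2 <= 1].

Hypothesis cF : simplexwise_continuous R (cylinder A) F.
Hypothesis F_in : forall p, cylinder A p -> B (F p).

Definition track n (s : singular_simplex R X n) (p : prism_space R n) : Y :=
  F (extend s p.1, p.2).

Lemma track_continuous n (s : singular_simplex R X n) : (forall t, A (s t)) ->
  simplexwise_continuous R (@prism R n) (track s).
Proof.
move=> sA m h ch hP; rewrite /track; apply: (cF (h := fun t => (extend s (h t).1, (h t).2))).
  apply: cont_pair; last exact: cont_snd.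
  apply: (@extend_continuous _ _ _ s m (fun t => (h t).1)); first exact: cont_fst.
  by move=> t; case: (hP t).
by move=> t; split; [exact: extend_in|case: (hP t)].
Qed.

Lemma track_in n (s : singular_simplex R X n) : (forall t, A (s t)) ->
  forall p, prism p -> B (track s p).
Proof. by move=> sA p [_ p01]; apply: F_in; split => //; apply: extend_in. Qed.

Lemma realize_prism_face k n (i : 'I_n.+2) (s : singular_simplex R X n.+1) w :
  (forall t, A (s t)) -> slist (@prism R n) k w ->
  realize k (track s) (map (prism_face i) w) = realize k (track (singular_face i s)) w.
Proof.
case: k => [//|k] sA wP.
have wP' : slist (@prism R n.+1) k.+1 (map (prism_face i) w).
  case: wP => sw wP; split=> [|_ /mapP[p /wP[p1 p2] ->]]; first by rewrite size_map.
  split => //; apply/set_mem/coface_row_std_simplex; exact/mem_set.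
apply/continuousEP => t.
rewrite (realizeE (@comb_closed_prism R n.+1)) //; last exact: track_continuous.
rewrite (realizeE (@comb_closed_prism R n)) //; last first.
  by apply: track_continuous => u; apply: sA.
rewrite comb_map /track extend_face //.
by have [] := comb_closed_prism t wP.
Qed.

Definition list_op := forall n, nat -> seq (prism_space R n) ->
  {freeg (seq (prism_space R n)) / int}.

(** The degree [k] is 0 for chain maps and 1 for homotopies. [op_nil] says that chain maps preserve
    the augmentation and that homotopies vanish in degree -1. *)
Record natural_op k (T : list_op) : Prop := NaturalOp {
  op_natural : forall n (i : 'I_n.+2), list_natural (prism_face i) (T n) (T n.+1);
  op_prism : forall n m l, slist (@prism R n) m l ->
    chain_on (slist (@prism R n) (k + m)) (T n m l);
  op_nil : forall n, T n 0%N [::] = if k is 0 then << [::] >> else 0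
}.

Definition act k (T : list_op) m : asimplex R X m -> achain R Y (k + m) :=
  match m return asimplex R X m -> achain R Y (k + m) with
  | 0 => fun _ => match k return achain R Y (k + 0) with
                  | 0 => << tt : asimplex R Y 0 >> | _ => 0 end
  | n.+1 => fun s => fglift (fun w => << realize (k + n.+1) (track s) w >>)
                            (T n n.+1 (verts R n))
  end.

Lemma act_in k T m (s : asimplex R X m) : natural_op k T -> simplex_in A s ->
  chain_on (@simplex_in R Y B (k + m)) (act k T s).
Proof.
case: m s => [s _ _|n s kT sA] /=.
  by case: k => [|k]; [exact: chain_on1|exact: chain_on0].
apply: chain_on_fglift (op_prism kT (verts_prism R n)) _ => w wP.
apply: chain_on1; apply: realize_in wP; first exact: comb_closed_prism.
  exact: track_continuous.
exact: track_in.
Qed.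

(** By naturality under [prism_face], operating on a face of [s] is the same as operating on the
    corresponding face of the universal simplex and then realizing along the track of [s]. *)
Lemma act_bd k T n (s : singular_simplex R X n) : natural_op k T ->
  (forall t, A (s t)) ->
  fglift (@act k T n) (bd_simplex (s : asimplex R X n.+1)) =
  fglift (fun w => << realize (k + n) (track s) w >>)
    (fglift (T n n) (list_bd (verts R n))).
Proof.
move=> kT sA; rewrite list_bdE /bd_simplex !raddf_sum; case: (verts_prism R n) => -> _.
apply: eq_bigr => i _; rewrite !raddfZsign /= !fglift1; congr (_ *: _).
(* The only face of a 0-simplex is the empty simplex, on which [act] is prescribed rather than
   realized; there [op_nil] gives the agreement. *)
case: n s sA i => [|n] s sA i /=.
  rewrite (_ : del i _ = [::]).
    by rewrite (op_nil kT); case: k {kT} => [|k] /=; rewrite ?fglift1 ?raddf0.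
  by apply: size0nil; rewrite /verts del_map size_map size_del size_enum_ord.
rewrite del_verts -(op_natural kT) /push raddf_fglift /=.
apply: eq_fglift (op_prism kT (verts_prism R n)) _ => w wP.
by rewrite fglift1 realize_prism_face.
Qed.


(** As prisms are convex, any two natural chain maps that preserve the augmentation are homotopic.
    Taking [id_op] against [top_op] gives homotopy invariance, and [id_op] against [sd_op k] gives
    the invariance under subdivision. *)
Definition htpy_op (T T' : list_op) : list_op :=
  fun n => cone_htpy (@centroid R _) (fun m l => T n m l - T' n m l).

Lemma htpy_op_natural T T' : natural_op 0 T -> natural_op 0 T' ->
  natural_op 1 (htpy_op T T').
Proof.
move=> kT kT'; split=> [n i|n m l lP|//].
  apply: cone_htpy_natural => [l|m l]; first exact: (centroid_map (prism_face i)).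
  by rewrite raddfB /= (op_natural kT) (op_natural kT').
apply: chain_on_cone_htpy lP => [p u|p u uP].
  by apply: centroid_in; exact: comb_closed_prism.
by apply: chain_onB; [exact: (op_prism kT uP)|exact: (op_prism kT' uP)].
Qed.

Lemma bd_htpy_op T T' n (s : asimplex R X n.+1) : natural_op 0 T -> natural_op 0 T' ->
  (forall n, list_chain_map (T n)) -> (forall n, list_chain_map (T' n)) ->
  simplex_in A s ->
  bd (act 1 (htpy_op T T') s) =
  act 0 T s - act 0 T' s - fglift (@act 1 (htpy_op T T') n) (bd_simplex s).
Proof.
move=> kT kT' cT cT' sA; have kH := htpy_op_natural kT kT'.
rewrite [act 1 _ s]/= [LHS](bd_realize (@comb_closed_prism R n) (track_continuous sA)
  (op_prism kH (verts_prism R n))).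
rewrite cone_htpyE; last first.
- by case: (verts_prism R n).
- by rewrite (op_nil kT) (op_nil kT') subrr.
- split=> [l l0|m l sl].
    by case: (cT n) (cT' n) => T0 _ [T'0 _]; rewrite raddfB /= T0 // T'0 // subrr.
  case: (cT n) (cT' n) => _ TS [_ T'S].
  by rewrite raddfB /= TS // T'S // fglift_add fglift_opp.
by rewrite act_bd // !raddfB.
Qed.

End Operators.

Section ListOperators.
Variable R : realType.

Definition id_op : list_op R := fun n m l => << l >>.
Arguments id_op : clear implicits.

Definition lift_top n (p : prism_space R n) : prism_space R n := (p.1, 1).

Definition top_op : list_op R := fun n m l => << map (@lift_top n) l >>.
Arguments top_op : clear implicits.

Lemma id_op_natural : natural_op 0 id_op.
Proof.
split=> // [n i m l|n m l lP]; first exact: fglift1.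
exact: chain_on1.
Qed.

Lemma id_op_chain_map n : list_chain_map (id_op n).
Proof. exact: list_chain_map_id. Qed.

Lemma top_op_natural : natural_op 0 top_op.
Proof.
split=> // [n i m l|n m l [sl lP]].
  by rewrite /top_op /push fglift1 -!map_comp.
apply: chain_on1; split=> [|_ /mapP[p /lP[p1 _] ->]]; first by rewrite size_map.
by split => //=; rewrite lexx ler01.
Qed.

Lemma top_op_chain_map n : list_chain_map (top_op n).
Proof.
split=> [l /size0nil->|m l _]; first by rewrite lbd1.
by rewrite lbd1 -push_list_bd.
Qed.

End ListOperators.

Section PushForward.
Variables (R : realType) (X Y : topologicalType) (A : set X) (f : X -> Y).
Hypothesis cf : simplexwise_continuous R A f.

Definition push_simplex m : asimplex R X m -> asimplex R Y m :=
  match m with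
  | 0 => fun _ => tt
  | n.+1 => fun s =>
      mk_simplex (fun t : std_simplex R n => f ((s : singular_simplex R X n) t))
  end.

Definition push_chain m (c : achain R X m) : achain R Y m :=
  fglift (fun s => << push_simplex s >>) c.

Lemma push_simplexE n (s : singular_simplex R X n) t : (forall t, A (s t)) ->
  (push_simplex (s : asimplex R X n.+1) : singular_simplex R Y n) t = f (s t).
Proof. by move=> sA; apply: mk_simplexE; apply: cf => //; exact: cts_fun. Qed.

Lemma aface_in m (i : 'I_m) (s : asimplex R X m) :
  simplex_in A s -> simplex_in A (aface i s).
Proof. by case: m i s => [[//]|[//|n]] i s sA t; apply: sA. Qed.

Lemma push_aface m (i : 'I_m) (s : asimplex R X m) : simplex_in A s ->
  aface i (push_simplex s) = push_simplex (aface i s).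
Proof.
case: m i s => [[//]|[//|n]] i s sA; apply/continuousEP => t.
rewrite [RHS]push_simplexE; last by move=> u; apply: sA.
exact: (push_simplexE (coface i t) sA).
Qed.

Lemma chain_on_bd m (c : achain R X m) :
  chain_on (@simplex_in R X A m) c -> chain_on (@simplex_in R X A m.-1) (bd c).
Proof.
move=> cA; apply: chain_on_fglift cA _ => s sA; apply: chain_on_sum => i _.
by apply: chain_onZ; apply: chain_on1; apply: aface_in.
Qed.

Lemma bd_push_chain m (c : achain R X m) : chain_on (@simplex_in R X A m) c ->
  bd (push_chain c) = push_chain (bd c).
Proof.
move: c; apply: chain_ind => [|c d|s sA]; rewrite /push_chain.
- by rewrite !raddf0.
- by rewrite !raddfB /= => -> ->.
rewrite !fglift1 !bd1 [RHS]raddf_sum; apply: eq_bigr => i _.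
by rewrite raddfZsign /= fglift1 push_aface.
Qed.

Lemma push_chain_in (B : set Y) m (c : achain R X m) : (forall x, A x -> B (f x)) ->
  chain_on (@simplex_in R X A m) c -> chain_on (@simplex_in R Y B m) (push_chain c).
Proof.
move=> fAB /chain_on_fglift; apply => s sA; apply: chain_on1.
by case: m c s sA => // n c s sA t; rewrite push_simplexE //; apply: fAB.
Qed.

End PushForward.

(** * Homotopy invariance *)

Section HomotopyInvariance.
Variables (R : realType) (X Y : topologicalType).
Variables (A : set X) (B : set Y) (F : X * R -> Y).
Hypothesis cF : simplexwise_continuous R (cylinder A) F.
Hypothesis F_in : forall p, cylinder A p -> B (F p).

Definition act0 (T : list_op R) m (s : asimplex R X m) : achain R Y m := act F 0 T s.
Definition act1 (T : list_op R) m (s : asimplex R X m) : achain R Y m.+1 := act F 1 T s.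

Lemma bd_fglift_htpy T T' n (c : achain R X n.+1) :
  natural_op 0 T -> natural_op 0 T' ->
  (forall n, list_chain_map (T n)) -> (forall n, list_chain_map (T' n)) ->
  chain_on (@simplex_in R X A n.+1) c ->
  bd (fglift (@act1 (htpy_op T T') n.+1) c) =
    fglift (@act0 T n.+1) c - fglift (@act0 T' n.+1) c
    - fglift (@act1 (htpy_op T T') n) (bd c) :> achain R Y n.+1.
Proof.
move=> kT kT' cT cT'; move: c; apply: chain_ind => [|c d|s sA].
- by rewrite !raddf0 !addr0.
- rewrite !raddfB /= => -> ->; rewrite !raddfB /=.
  by rewrite !opprK [LHS]addrACA [X in X + _]addrACA.
rewrite !fglift1 bd1; exact: (bd_htpy_op cF kT kT' cT cT' sA).
Qed.

Lemma act_cycle T T' m (c : achain R X m) : natural_op 0 T -> natural_op 0 T' ->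
  (forall n, list_chain_map (T n)) -> (forall n, list_chain_map (T' n)) ->
  chain_on (@simplex_in R X A m) c -> bd c = 0 ->
  exists2 e : achain R Y m.+1, chain_on (@simplex_in R Y B m.+1) e &
    bd e = fglift (@act0 T m) c - fglift (@act0 T' m) c.
Proof.
move=> kT kT' cT cT'; case: m c => [|n] c cA c0.
  (* Both operators fix the empty simplex, so the difference to be filled is zero. *)
  exists 0; first exact: chain_on0.
  by rewrite raddf0 [X in _ - X](eq_fglift cA (g := @act0 T 0)) ?subrr // => -[].
exists (fglift (@act1 (htpy_op T T') n.+1) c).
  apply: chain_on_fglift cA _ => s sA.
  exact: (act_in cF F_in (htpy_op_natural kT kT') sA).
by rewrite bd_fglift_htpy // c0 raddf0 subr0.
Qed.

Lemma act_id m (s : asimplex R X m) : simplex_in A s ->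
  act0 (@id_op R) s = << push_simplex (fun x => F (x, 0)) s >>.
Proof.
case: m s => [//|n] s sA; rewrite /= fglift1; congr << _ >>; apply/continuousEP => t.
have c0 : simplexwise_continuous R A (fun x => F (x, 0)).
  move=> k h ch hA; apply: (cF (h := fun t => (h t, 0))).
    by apply: cont_pair => //; apply: cont_cst.
  by move=> u; split => //=; rewrite lexx ler01.
rewrite (push_simplexE c0) //.
rewrite (realizeE (@comb_closed_prism R n) (track_continuous cF sA)) ?comb_verts.
  by rewrite /track extend_val.
exact: verts_prism.
Qed.

Lemma act_top m (s : asimplex R X m) : simplex_in A s ->
  act0 (@top_op R) s = << push_simplex (fun x => F (x, 1)) s >>.
Proof.
case: m s => [//|n] s sA; rewrite /= fglift1; congr << _ >>; apply/continuousEP => t.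
have c1 : simplexwise_continuous R A (fun x => F (x, 1)).
  move=> k h ch hA; apply: (cF (h := fun t => (h t, 1))).
    by apply: cont_pair => //; apply: cont_cst.
  by move=> u; split => //=; rewrite lexx ler01.
rewrite (push_simplexE c1) //.
have topP : slist (@prism R n) n.+1 (map (@lift_top R n) (verts R n)).
  have [sl lP] := verts_prism R n; split; first by rewrite size_map.
  by move=> _ /mapP[p /lP[p1 _] ->]; split => //=; rewrite lexx ler01.
rewrite (realizeE (@comb_closed_prism R n) (track_continuous cF sA)) //.
suff -> : comb (val t) (map (@lift_top R n) (verts R n)) = (val t, 1).
  by rewrite /track extend_val.
apply/eqP; rewrite -pair_eqE; apply/andP; split; apply/eqP.
  rewrite -[RHS](f_equal fst (comb_verts (val t))).
  apply/rowP => j; rewrite !comb_fst; apply: eq_bigr => i _.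
  by rewrite (nth_map 0) // size_map size_enum_ord.
rewrite comb_snd; have /set_mem[_ <-] := valP t; apply: eq_bigr => i _.
by rewrite (nth_map 0) ?mulr1 // size_map size_enum_ord.
Qed.

Lemma push_homotopic m (c : achain R X m) :
  chain_on (@simplex_in R X A m) c -> bd c = 0 ->
  exists2 e : achain R Y m.+1, chain_on (@simplex_in R Y B m.+1) e &
    bd e = push_chain (fun x => F (x, 0)) c - push_chain (fun x => F (x, 1)) c.
Proof.
move=> cA c0; have [e eB eE] := act_cycle (@id_op_natural R) (@top_op_natural R)
  (@id_op_chain_map R) (@top_op_chain_map R) cA c0.
by exists e => //; rewrite eE; congr (_ - _); apply: eq_fglift cA _ => s;
  [exact: act_id|exact: act_top].
Qed.

End HomotopyInvariance.

Section Vanish.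
Variable R : realType.

(* [vanish 0 A] means that [A] is nonempty, and [vanish m.+1 A] that the reduced
   homology of [A] is trivial in degree [m]. *)
Definition vanish m (X : topologicalType) (A : set X) : Prop :=
  forall c : achain R X m, chain_on (@simplex_in R X A m) c -> bd c = 0 ->
  exists2 b : achain R X m.+1, chain_on (@simplex_in R X A m.+1) b & bd b = c.

Lemma push_chain_comp (X Y Z : topologicalType) (A : set X) (B : set Y) (f : X -> Y)
    (g : Y -> Z) (h : X -> Z) m (c : achain R X m) :
  simplexwise_continuous R A f -> (forall x, A x -> B (f x)) ->
  simplexwise_continuous R B g -> (forall x, A x -> h x = g (f x)) ->
  chain_on (@simplex_in R X A m) c ->
  push_chain h c = push_chain g (push_chain f c).
Proof.
move=> cf fAB cg hE cA; rewrite /push_chain raddf_fglift /=.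
apply: eq_fglift cA _ => s sA; rewrite fglift1; congr << _ >>.
case: m c s sA => [//|n] c s sA; apply/continuousEP => t.
have ch : simplexwise_continuous R A h.
  move=> k u cu uA; rewrite (_ : (fun t => _) = fun t => g (f (u t))).
    by apply: (cg _ (fun t => f (u t))) => [|v]; [exact: cf|apply: fAB].
  by apply/funext => v; rewrite hE.
rewrite (push_simplexE ch) // hE //.
rewrite (push_simplexE cg) => [|u]; rewrite (push_simplexE cf) //; exact: fAB.
Qed.

Lemma push_chain_id (X : topologicalType) (A : set X) (f : X -> X) m
    (c : achain R X m) : (forall x, A x -> f x = x) ->
  chain_on (@simplex_in R X A m) c -> push_chain f c = c.
Proof.
move=> fE cA; rewrite -[RHS]fglift_id; apply: eq_fglift cA _ => s sA.
congr << _ >>; case: m c s sA => [c []//|n] c s sA; apply/continuousEP => t.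
have cf : simplexwise_continuous R A f.
  by move=> k u cu uA; rewrite (_ : (fun t => _) = u) //; apply/funext => v; rewrite fE.
by rewrite (push_simplexE cf) // fE.
Qed.

(** Fill the image of the cycle in [B], bring the filling back by [g], and add the homotopy from the
    identity to [g \o f]. *)
Lemma vanish_dominated (X Y : topologicalType) (A : set X) (B : set Y) (f : X -> Y)
    (g : Y -> X) (F : X * R -> X) m :
  simplexwise_continuous R A f -> (forall x, A x -> B (f x)) ->
  simplexwise_continuous R B g -> (forall y, B y -> A (g y)) ->
  simplexwise_continuous R (cylinder A) F -> (forall p, cylinder A p -> A (F p)) ->
  (forall x, A x -> F (x, 0) = x) -> (forall x, A x -> F (x, 1) = g (f x)) ->
  vanish m B -> vanish m A.
Proof.
move=> cf fAB cg gBA cF FA F0 F1 vB c cA c0.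
have [b bB bE] : exists2 b : achain R Y m.+1, chain_on (@simplex_in R Y B m.+1) b &
    bd b = push_chain f c.
  by apply: vB; [exact: push_chain_in cf _ _ _ fAB cA|
    rewrite (bd_push_chain cf cA) c0 /push_chain raddf0].
have [e eA eE] := push_homotopic cF FA cA c0.
exists (e + push_chain g b).
  by apply: chain_onD => //; exact: push_chain_in cg _ _ _ gBA bB.
rewrite raddfD /= eE (bd_push_chain cg bB) bE (push_chain_id F0 cA).
by rewrite (push_chain_comp cf fAB cg F1 cA) subrK.
Qed.

Lemma vanish_retract (X Y : topologicalType) (A : set X) (B : set Y) (f : X -> Y)
    (g : Y -> X) m :
  simplexwise_continuous R A f -> (forall x, A x -> B (f x)) ->
  simplexwise_continuous R B g -> (forall y, B y -> A (g y)) ->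
  (forall x, A x -> g (f x) = x) ->
  vanish m B -> vanish m A.
Proof.
move=> cf fAB cg gBA gf; apply: (vanish_dominated (F := fst) cf fAB cg gBA) => //.
- by move=> n h ch hA; apply: cont_fst.
- by move=> p [].
- by move=> x Ax; rewrite gf.
Qed.

End Vanish.

(** * Barycentric subdivision and the Mayer-Vietoris sequence *)

Section Mesh.
Variables (R : realType) (E : normedModType R).
Implicit Types (l w : seq E) (r : R).

Definition diameter_le r l := {in l &, forall x y, `|x - y| <= r}.

(* Contained in every ball containing [l], which is all that is needed of the
   convex hull. *)
Definition in_hull l w := forall y r, {in l, forall u, `|u - y| <= r} ->
  {in w, forall x, `|x - y| <= r}.

Lemma centroid_subE l u : l != [::] ->
  centroid l - u = (size l)%:R^-1 *: \sum_(x <- l) (x - u).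
Proof.
move=> l0; rewrite sumrB big_const_seq count_predT iter_addr addr0 scalerBr.
by rewrite -[u *+ _]scaler_nat scalerA mulVf ?scale1r // pnatr_eq0 size_eq0.
Qed.

Lemma centroid_hull l : l != [::] -> in_hull l [:: centroid l].
Proof.
move=> l0 y r ly x; rewrite inE => /eqP->; rewrite centroid_subE // normrZ.
have s0 : 0 < (size l)%:R :> R by rewrite ltr0n lt0n size_eq0.
rewrite gtr0_norm ?invr_gt0 // ler_pdivrMl //.
apply: (le_trans (ler_norm_sum _ _ _)); rewrite mulr_natl -sum1_size -sumrMnr big_seq.
by rewrite [leRHS]big_seq; apply: ler_sum => u ul; rewrite mulr1n; apply: ly.
Qed.

(** In the mean of the differences to [u] the term of [u] itself vanishes, which leaves [size l - 1]
    terms of norm at most [r]. *)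
Lemma centroid_dist r l u : diameter_le r l -> u \in l ->
  `|u - centroid l| <= (1 - (size l)%:R^-1) * r.
Proof.
move=> lr ul; have l0 : l != [::] by case: l ul {lr}.
have s0 : 0 < (size l)%:R :> R by rewrite ltr0n lt0n size_eq0.
rewrite distrC centroid_subE // normrZ gtr0_norm ?invr_gt0 // ler_pdivrMl //.
rewrite mulrA mulrBr mulr1 divff ?gt_eqF //.
rewrite (perm_big _ (perm_to_rem ul)) big_cons subrr /= add0r.
apply: (le_trans (ler_norm_sum _ _ _)).
have -> : ((size l)%:R - 1) * r = \sum_(x <- rem u l) r.
  rewrite big_const_seq count_predT iter_addr addr0 size_rem // -[RHS]mulr_natl.
  by rewrite -subn1 natrB // lt0n size_eq0.
rewrite big_seq [leRHS]big_seq; apply: ler_sum => x xl; apply: lr => //.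
exact: mem_rem xl.
Qed.

Lemma mesh_le_S n r : (0 < n)%N -> 0 <= r ->
  (1 - n%:R^-1) * r <= (1 - n.+1%:R^-1) * r.
Proof.
move=> n0 r0; rewrite ler_wpM2r // lerB // lef_pV2 ?posrE ?ltr0n // ler_nat.
exact: leqW.
Qed.

(** The clause [in_hull] is carried through the induction because the estimate from [centroid l] to
    the points of [l] must extend to the vertices of the subdivided faces. *)
Lemma subdiv_mesh n r l : size l = n -> diameter_le r l ->
  chain_on (fun w => [/\ size w = n, diameter_le ((1 - n%:R^-1) * r) w & in_hull l w])
    (subdiv (@centroid R E) n l).
Proof.
elim: n l => [|n IHn] l ln lr /=.
  by apply: chain_on1; rewrite (size0nil ln); split.
have l0 : l != [::] by rewrite -size_eq0 ln.
have r0 : 0 <= r.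
  case: l lr l0 {ln} => // x l lr _.
  by apply: le_trans (lr x x _ _); rewrite ?mem_head ?subrr ?normr0.
have lbdP : chain_on (slist (fun x => x \in l) n) (list_bd l).
  by apply: (@chain_on_list_bd _ _ n.+1); split.
have/chain_on_fglift : chain_on
    (fun w => [/\ size w = n, diameter_le ((1 - n%:R^-1) * r) w & in_hull l w])
    (fglift (subdiv (@centroid R E) n) (list_bd l)).
  apply: chain_on_fglift lbdP _ => l' [l'n l'l].
  have l'r : diameter_le r l' by move=> x y /l'l xl /l'l yl; apply: lr.
  apply: chain_on_sub (IHn l' l'n l'r) => w [wn wr wh]; split=> // y r' ly.
  by apply: wh => u /l'l/ly.
apply=> w [wn wr wh]; apply: chain_on1.
have wb x : x \in w -> `|x - centroid l| <= (1 - n.+1%:R^-1) * r.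
  by apply: wh => u ul; rewrite -ln; apply: centroid_dist.
split=> [|x y|y r' ly x]; first by rewrite /= wn.
  rewrite !inE => /orP[/eqP->|xw] /orP[/eqP->|yw].
  - rewrite subrr normr0 mulr_ge0 // subr_ge0 invf_le1 ?ltr0n //.
    by rewrite ler1n.
  - by rewrite distrC; apply: wb.
  - exact: wb.
  - apply: le_trans (wr _ _ xw yw) (mesh_le_S _ r0).
    by rewrite -wn; case: (w) xw.
rewrite inE => /orP[xb|xw]; last exact: wh xw.
by apply: (centroid_hull l0 ly); rewrite inE.
Qed.

End Mesh.

Section IteratedSubdivision.
Variable R : realType.

Fixpoint sd_op k : list_op R := fun n m l =>
  if k is k'.+1 then fglift (sd_op k' m) (subdiv (@centroid R _) m l) else << l >>.
Arguments sd_op : clear implicits.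

Lemma centroid_prism n m l : slist (@prism R n) m.+1 l -> prism (centroid l).
Proof. by apply: centroid_in; exact: comb_closed_prism. Qed.

Lemma sd_op_natural k : natural_op 0 (sd_op k).
Proof.
elim: k => [|k IHk]; first exact: id_op_natural.
split=> [n i m l|n m l lP|n] /=.
- rewrite -(@subdiv_natural _ _ (prism_face i) (@centroid R _)); last first.
    by move=> l'; exact: (centroid_map (prism_face i)).
  rewrite [LHS]raddf_fglift [in RHS]/push raddf_fglift /=.
  by apply: (@eq_fglift _ (fun=> True)) => // l' _; rewrite fglift1 (op_natural IHk).
- apply: chain_on_fglift (chain_on_subdiv (@centroid_prism n) lP) _ => l' l'P.
  exact: (op_prism IHk l'P).
- by rewrite fglift1 (op_nil IHk).
Qed.

Lemma sd_op_chain_map k n : list_chain_map (sd_op k n).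
Proof.
elim: k => [|k IHk]; first exact: id_op_chain_map.
have [S0 SS] := subdiv_list_chain_map (@centroid R (prism_space R n)).
split=> [l /size0nil->|m l lm] /=; first by rewrite fglift1; case: IHk => ->.
rewrite (list_chain_mapE IHk (n := m.+1)); last first.
  by apply: chain_on_subdiv => //; split.
rewrite SS // [LHS]raddf_fglift.
by apply: (@eq_fglift _ (fun=> True)).
Qed.

Lemma sd_op_mesh k n m r l : slist (@prism R n) m l -> diameter_le r l ->
  chain_on (fun w => slist (@prism R n) m w /\ diameter_le ((1 - m%:R^-1) ^+ k * r) w)
    (sd_op k n m l).
Proof.
elim: k r l => [|k IHk] r l lP lr /=.
  by apply: chain_on1; rewrite expr0 mul1r.
apply: chain_on_fglift (chain_onI (chain_on_subdiv (@centroid_prism n) lP)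
  (subdiv_mesh _ lr)) _; first by case: lP.
by move=> w [wP [_ wr _]]; rewrite exprSr -mulrA; apply: IHk.
Qed.

Lemma diameter_exists (E : normedModType R) (l : seq E) : exists r, diameter_le r l.
Proof.
exists (2 * \sum_(x <- l) `|x|) => x y xl yl.
have le_sum z : z \in l -> `|z| <= \sum_(x <- l) `|x|.
  move=> zl; rewrite (perm_big _ (perm_to_rem zl)) big_cons /= lerDl.
  exact: sumr_ge0.
by rewrite mulr_natl mulr2n (le_trans (ler_normB _ _)) // lerD // le_sum.
Qed.

(** All large [k] are needed, not just one, so that the finitely many simplices of a chain admit a
    common [k]. *)
Lemma sd_op_fine n (e : R) : 0 < e -> exists k0, forall k, (k0 <= k)%N ->
  chain_on (fun w => slist (@prism R n) n.+1 w /\ diameter_le e w)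
    (sd_op k n n.+1 (verts R n)).
Proof.
move=> e0; have [r vr] := diameter_exists (verts R n).
set q := 1 - n.+1%:R^-1 : R.
have q1 : `|q| < 1.
  rewrite ger0_norm ?subr_ge0 ?invf_le1 ?ler1n ?ltr0n //.
  by rewrite ltrBlDr ltrDl invr_gt0 ltr0n.
have : (fun k => q ^+ k * r) @ \oo --> 0 * r.
  by apply: cvgMl; exact: cvg_expr.
rewrite mul0r => /cvgrPdist_lt/(_ e e0)[k0 _ k0P]; exists k0 => k kk0.
apply: (chain_on_sub _ (sd_op_mesh (verts_prism R n) vr)) => w [wP wr].
split=> // x y xw yw.
apply: (le_trans (wr x y xw yw)); rewrite -/q.
by have := k0P k kk0; rewrite /= sub0r normrN => /ltW; apply: le_trans; exact: ler_norm.
Qed.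

End IteratedSubdivision.

(** * Lebesgue numbers of two-set covers of a simplex *)

Section Lebesgue.
Variables (R : realType) (n : nat).

Lemma std_simplex_compact : compact (std_simplex R n).
Proof.
apply: (@subclosed_compact _ _ [set v : 'rV[R]_n.+1 | forall i, `[0, 1]%classic (v ord0 i)]).
- rewrite (_ : std_simplex R n = \bigcap_i [set x : 'rV[R]_n.+1 | 0 <= x ord0 i] `&`
     [set x | \sum_(i < n.+1) x ord0 i = 1]); last first.
    by apply/seteqP; split=> x [x0 x1]; split=> // i; [move=> _|]; apply: x0.
  apply: closedI.
    apply: closed_bigI => i _.
    apply: (@preimage_closed _ _ (fun x : 'rV[R]_n.+1 => x ord0 i) [set x | 0 <= x]).
      by move=> x _; exact: coord_continuous.
    exact: closed_ge.
  apply: (@preimage_closed _ _ (fun x : 'rV[R]_n.+1 => \sum_i x ord0 i) [set x | x = 1]).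
    by move=> x _; move: x; apply: cont_sum => i x; exact: coord_continuous.
  exact: closed_eq.
- have: ('I_n.+1 -> compact `[0 : R, 1]) := fun=> @segment_compact R 0 1.
  exact: (@rV_compact R n.+1 (fun=> `[0, 1]%classic)).
move=> x [x0 x1] i; rewrite /= in_itv /= x0 -x1 (bigD1 i) //= lerDl.
by apply: sumr_ge0.
Qed.

Lemma lebesgue_number (X : topologicalType) (OA OB : set X) (s : singular_simplex R X n) :
  open OA -> open OB -> (forall t, OA (s t) \/ OB (s t)) ->
  exists2 e : R, 0 < e & forall x, std_simplex R n x ->
    (forall y, std_simplex R n y -> `|y - x| <= e -> OA (extend s y)) \/
    (forall y, std_simplex R n y -> `|y - x| <= e -> OB (extend s y)).
Proof.
move=> oA oB sAB.
have rel_open (O : set X) x : open O -> std_simplex R n x -> O (extend s x) ->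
    exists2 r : R, 0 < r & forall y, std_simplex R n y -> `|y - x| < r -> O (extend s y).
  move=> oO /mem_set xP Ox.
  pose t : std_simplex R n := exist (fun x => x \in std_simplex R n) x xP.
  have : nbhs t (s @^-1` O).
    apply: (@cts_fun _ _ s t); apply: open_nbhs_nbhs; split => //.
    by rewrite -extend_val.
  case=> _ [[W oW <-] /= Wt WO].
  have : nbhs x W by apply: open_nbhs_nbhs.
  move=> /nbhs_normP[r /= r0 rW]; exists r => // y /mem_set yP yx.
  have := WO (exist (fun x => x \in std_simplex R n) y yP).
  rewrite /= -extend_val; apply.
  by apply: rW; rewrite /= distrC.
have /compact_near_coveringP K := std_simplex_compact.
pose P (e : R) x := std_simplex R n x ->
    (forall y, std_simplex R n y -> `|y - x| <= e -> OA (extend s y)) \/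
    (forall y, std_simplex R n y -> `|y - x| <= e -> OB (extend s y)).
(* By the near-covering form of compactness it is enough that every point has a neighbourhood on
   which all small [e] work; half of a radius given by [rel_open] serves for both the neighbourhood
   and the bound on [e]. *)
have : \forall e \near 0^'+, std_simplex R n `<=` P e.
  apply: K => x xP.
  have half (O : set X) : open O -> O (extend s x) ->
      \forall x' \near x & e \near 0^'+,
      forall y, std_simplex R n y -> `|y - x'| <= e -> O (extend s y).
    move=> oO /(rel_open O x oO xP)[r r0 rO].
    have r2 : 0 < r / 2 by rewrite divr_gt0.
    exists (ball x (r / 2), [set e | e < r / 2]) => /=.
      split; first exact: nbhsx_ballx.
      exact: nbhs_right_lt.
    move=> [x' e] [/= xx' er] y yP yx'; apply: rO => //.
    rewrite (splitr r) -(subrKA x') (le_lt_trans (ler_normD _ _)) // ltrD //.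
      exact: le_lt_trans er.
    by move: xx'; rewrite -ball_normE /= distrC.
  case: (sAB (insubd (vertex0 R n) x)) => [/(half OA oA)|/(half OB oB)];
    apply: filterS => -[x' e] /= H x'P; first by left.
  by right.
move=> /(filterI (nbhs_right_gt 0))/filter_ex[e [e0 eP]].
by exists e => // x xP; exact: eP.
Qed.

End Lebesgue.

(** * Small chains and exactness for an open cover *)

Section MayerVietoris.
Variables (R : realType) (X : topologicalType).

(** With the constant homotopy [fst], list operators act on the singular chains of a fixed space;
    this is how subdivision is applied below. *)
Lemma fst_continuous (A : set X) :
  simplexwise_continuous R (cylinder A) (fst : X * R -> X).
Proof. by move=> n h ch _; apply: cont_fst. Qed.

Lemma fst_in (A : set X) (p : X * R) : cylinder A p -> A p.1.
Proof. by case. Qed.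

Lemma act0_id m (s : asimplex R X m) : act0 fst (@id_op R) s = << s >>.
Proof.
have sT : simplex_in setT s by case: m s.
rewrite (act_id (@fst_continuous setT) sT) -[RHS](push_chain_id (f := id) (A := setT)) //.
  by rewrite /push_chain fglift1.
exact: chain_on1.
Qed.

(** A singular simplex is the realization of [verts n] along its own track, so the identity is
    inherited from [lbd_list_bd]. *)
Lemma bd_bd m (c : achain R X m) : bd (bd c) = 0.
Proof.
have : chain_on (@simplex_in R X setT m) c by move=> s _; case: m s {c}.
move: c; apply: chain_ind => [|c d|s sT].
- by rewrite !raddf0.
- by rewrite !raddfB /= => -> ->; rewrite subrr.
rewrite -act0_id; case: m s sT => [s _|n s sT].
  by rewrite /= bd1 /bd_simplex !big_ord0 raddf0.
have cT := track_continuous (@fst_continuous setT) sT.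
have vP := verts_prism R n.
rewrite /act0 /= fglift1 -[<< _ >>](fglift1 (fun w => << realize n.+1 (track fst s) w >>)).
rewrite (bd_realize (@comb_closed_prism R n) cT); last exact: chain_on1.
rewrite lbd1 (bd_realize (@comb_closed_prism R n) cT); last exact: chain_on_list_bd vP.
by rewrite lbd_list_bd raddf0.
Qed.

Section Cover.
Variables (OA OB Z : set X).
Hypotheses (oA : open OA) (oB : open OB) (ZAB : Z `<=` OA `|` OB).
Let A := Z `&` OA.
Let B := Z `&` OB.

Definition small_simplex m (s : asimplex R X m) := simplex_in A s \/ simplex_in B s.

Lemma small_chain_split m (c : achain R X m) : chain_on (@small_simplex m) c ->
  exists a b, [/\ chain_on (@simplex_in R X A m) a,
    chain_on (@simplex_in R X B m) b & c = a + b].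
Proof.
move: c; apply: chain_ind => [|c d [a [b [aA bB ->]]] [a' [b' [aA' bB' ->]]]|s [sA|sB]].
- by exists 0, 0; split; rewrite ?addr0 //; apply: chain_on0.
- exists (a - a'), (b - b'); split; rewrite ?opprD 1?addrACA //; exact: chain_onB.
- by exists << s >>, 0; split; rewrite ?addr0 //; [exact: chain_on1|exact: chain_on0].
- by exists 0, << s >>; split; rewrite ?add0r //; [exact: chain_on0|exact: chain_on1].
Qed.

Lemma act1_small T m (s : asimplex R X m) : natural_op 1 T -> small_simplex s ->
  chain_on (@small_simplex m.+1) (act1 fst T s).
Proof.
move=> kT [sA|sB].
  apply: chain_on_sub (act_in (@fst_continuous A) (@fst_in A) kT sA).
  by move=> s' s'A; left.
apply: chain_on_sub (act_in (@fst_continuous B) (@fst_in B) kT sB).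
by move=> s' s'B; right.
Qed.

Lemma subdivision_small n (s : singular_simplex R X n) : (forall t, Z (s t)) ->
  exists k0, forall k, (k0 <= k)%N ->
  chain_on (@small_simplex n.+1) (act0 fst (@sd_op R k) (s : asimplex R X n.+1)).
Proof.
move=> sZ; have [|e e0 eP] := @lebesgue_number R n X OA OB s oA oB.
  by move=> t; apply: ZAB.
have [k0 k0P] := sd_op_fine n e0; exists k0 => k kk0.
apply: chain_on_fglift (k0P k kk0) _ => w [wP we]; apply: chain_on1.
have [w0 w0w ws] : exists2 w0, w0 \in w & size w = n.+1.
  case: (wP) => wn _; case: (w) wn => // x w' wn.
  by exists x; rewrite ?mem_head.
(* The affine simplex on a list of diameter at most [e] stays within [e] of any of its vertices, so
   the Lebesgue number at [w0.1] places it on one side of the cover. *)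
have near_w0 (t : std_simplex R n) : `|(comb (val t) w).1 - w0.1| <= e.
  apply: (@le_trans _ _ `|comb (val t) w - w0|).
    by rewrite [leRHS]prod_normE le_max lexx.
  have /set_mem[t0 t1] := valP t.
  rewrite -[w0]scale1r -{1}t1 scaler_suml /comb -sumrB.
  apply: (le_trans (ler_norm_sum _ _ _)); rewrite -[e]mul1r -t1 mulr_suml.
  apply: ler_sum => i _; rewrite -scalerBr normrZ ger0_norm //.
  by apply: ler_wpM2l => //; apply: we => //; apply: mem_nth; rewrite ws.
have trackE (t : std_simplex R n) :
    (realize n.+1 (track fst s) w : singular_simplex R X n) t = extend s (comb (val t) w).1.
  by apply: (realizeE (@comb_closed_prism R n) (track_continuous (@fst_continuous Z) sZ)).
have combP (t : std_simplex R n) : std_simplex R n (comb (val t) w).1.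
  by case: (comb_closed_prism t wP).
case: (wP) => _ /(_ _ w0w)/= [w0P _].
by case: (eP _ w0P) => H; [left|right] => t; rewrite trackE; split;
  [exact: extend_in|apply: H|exact: extend_in|apply: H].
Qed.

Lemma chain_subdivision_small n (c : achain R X n.+1) :
  chain_on (@simplex_in R X Z n.+1) c ->
  exists k0, forall k, (k0 <= k)%N ->
  chain_on (@small_simplex n.+1) (fglift (@act0 R X X fst (@sd_op R k) n.+1) c).
Proof.
move: c; apply: chain_ind => [|c d [k0 ck] [k1 dk]|s sZ].
- by exists 0%N => k _; rewrite raddf0; apply: chain_on0.
- exists (maxn k0 k1) => k; rewrite geq_max => /andP[k0k k1k].
  by rewrite raddfB; apply: chain_onB; [exact: ck|exact: dk].
by have [k0 k0P] := subdivision_small sZ; exists k0 => k kk0; rewrite fglift1; exact: k0P.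
Qed.

(** For the homotopy H from the identity to a fine subdivision sd, bd (H c) = c - sd c - H (bd c).
    The small chain is sd c + H (bd c): its last term is small because H does not leave the image of
    a simplex. *)
Lemma small_chain n (c : achain R X n.+1) : chain_on (@simplex_in R X Z n.+1) c ->
  chain_on (@small_simplex n) (bd c) ->
  exists c' e, [/\ chain_on (@small_simplex n.+1) c',
    chain_on (@simplex_in R X Z n.+2) e & bd e = c - c'].
Proof.
move=> cZ cs; have [k /(_ k (leqnn k)) ck] := chain_subdivision_small cZ.
have kid := id_op_natural R; have ksd := sd_op_natural R k.
have kH := htpy_op_natural kid ksd.
set H := htpy_op _ _ in kH.
exists (fglift (@act0 R X X fst (@sd_op R k) n.+1) c + fglift (@act1 R X X fst H n) (bd c)).
exists (fglift (@act1 R X X fst H n.+1) c); split.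
- apply: chain_onD => //; apply: chain_on_fglift cs _ => s; exact: act1_small.
- apply: chain_on_fglift cZ _ => s; exact: (act_in (@fst_continuous Z) (@fst_in Z) kH).
rewrite (bd_fglift_htpy (@fst_continuous Z) kid ksd
  (@id_op_chain_map R) (@sd_op_chain_map R k) cZ).
rewrite opprD addrA; congr (_ - _ - _).
by rewrite -[RHS]fglift_id; apply: eq_fglift cZ _ => s _; apply: act0_id.
Qed.

(** Fill the cycle by [a] in [A] and by [b] in [B]; the cycle [a - b] bounds in [Z], and the filling
    may be replaced by a small one [eA + eB]. Then [a - bd eA = b + bd eB] is supported both in [A]
    and in [B], hence in the intersection. *)
Lemma vanish_setI m : vanish R m.+1 Z -> vanish R m A -> vanish R m B ->
  vanish R m (Z `&` (OA `&` OB)).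
Proof.
move=> vZ vA vB c cI c0.
have cA : chain_on (@simplex_in R X A m) c.
  by apply: chain_on_sub cI; case: (m) => // n s sI t; case: (sI t) => ? [].
have cB : chain_on (@simplex_in R X B m) c.
  by apply: chain_on_sub cI; case: (m) => // n s sI t; case: (sI t) => ? [].
have [a aA ac] := vA c cA c0; have [b bB bc] := vB c cB c0.
have AZ k : forall s, @simplex_in R X A k s -> simplex_in Z s.
  by case: k => // k s sA t; case: (sA t).
have BZ k : forall s, @simplex_in R X B k s -> simplex_in Z s.
  by case: k => // k s sB t; case: (sB t).
have abZ : chain_on (@simplex_in R X Z m.+1) (a - b).
  by apply: chain_onB; [exact: chain_on_sub (AZ _) aA|exact: chain_on_sub (BZ _) bB].
have [e eZ eE] : exists2 e : achain R X m.+2,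
    chain_on (@simplex_in R X Z m.+2) e & bd e = a - b.
  by apply: vZ => //; rewrite raddfB /= ac bc subrr.
have abs : chain_on (@small_simplex m.+1) (bd e).
  rewrite eE; apply: chain_onB; first by apply: chain_on_sub aA => s sA; left.
  by apply: chain_on_sub bB => s sB; right.
have [e' [f [e's _ fE]]] := small_chain eZ abs.
have bde' : bd e' = a - b.
  by have := bd_bd f; rewrite fE raddfB /= eE => /eqP; rewrite subr_eq0 => /eqP.
have [eA [eB [eAA eBB e'E]]] := small_chain_split e's.
have abE : a - bd eA = b + bd eB.
  apply/eqP; rewrite subr_eq -addrA [bd eB + _]addrC -raddfD /= -e'E bde'.
  by rewrite addrC subrK.
exists (a - bd eA); last by rewrite raddfB /= (bd_bd eA) subr0 ac.
have sA : chain_on (@simplex_in R X A m.+1) (a - bd eA).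
  by apply: chain_onB => //; exact: (chain_on_bd eAA).
have sB : chain_on (@simplex_in R X B m.+1) (a - bd eA).
  by rewrite abE; apply: chain_onD => //; exact: (chain_on_bd eBB).
apply: chain_on_sub (chain_onI sA sB) => s [] /= sA' sB' t.
by case: (sA' t) (sB' t) => ? ? [].
Qed.

Lemma vanish_setU m : vanish R m (Z `&` (OA `&` OB)) -> vanish R m.+1 A ->
  vanish R m.+1 B -> vanish R m.+1 Z.
Proof.
move=> vI vA vB c cZ c0.
have [|c' [e [c's eZ eE]]] := small_chain cZ; first by rewrite c0; exact: chain_on0.
have [a [b [aA bB c'E]]] := small_chain_split c's.
have AZ k : forall s, @simplex_in R X A k s -> simplex_in Z s.
  by case: k => // k s sA t; case: (sA t).
have BZ k : forall s, @simplex_in R X B k s -> simplex_in Z s.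
  by case: k => // k s sB t; case: (sB t).
have bdc' : bd c' = 0.
  by have := bd_bd e; rewrite eE raddfB /= c0 sub0r => /eqP; rewrite oppr_eq0 => /eqP.
have abE : bd a = - bd b.
  by apply/eqP; rewrite -subr_eq0 opprK -raddfD /= -c'E bdc'.
have sI : chain_on (@simplex_in R X (Z `&` (OA `&` OB)) m) (bd a).
  have sA : chain_on (@simplex_in R X A m) (bd a) by exact: chain_on_bd aA.
  have sB : chain_on (@simplex_in R X B m) (bd a).
    by rewrite abE; apply: chain_onN; exact: chain_on_bd bB.
  apply: chain_on_sub (chain_onI sA sB); case: (m) => // n s [] /= sA' sB' t.
  by case: (sA' t) (sB' t) => ? ? [].
have [x xI xE] := vI _ sI (bd_bd a).
have xA : chain_on (@simplex_in R X A m.+1) x.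
  by apply: chain_on_sub xI => s sI' t; case: (sI' t) => ? [].
have xB : chain_on (@simplex_in R X B m.+1) x.
  by apply: chain_on_sub xI => s sI' t; case: (sI' t) => ? [].
have [|p pA pE] := vA (a - x) (chain_onB aA xA); first by rewrite raddfB /= xE subrr.
have [|q qB qE] := vB (b + x) (chain_onD bB xB).
  by rewrite raddfD /= xE abE subrr.
exists (e + (p + q)).
  apply: chain_onD => //; apply: chain_onD.
    exact: chain_on_sub (AZ _) pA.
  exact: chain_on_sub (BZ _) qB.
by rewrite !raddfD /= eE pE qE [X in _ + X]addrACA addNr addr0 -c'E subrK.
Qed.

End Cover.
End MayerVietoris.

(** * Spheres and punctured spheres *)

Section Contractible.
Variables (R : realType) (X : topologicalType).

Lemma chain0E (c : achain R X 0) : exists k : int, c = k *: << tt : asimplex R X 0 >>.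
Proof.
have : chain_on (fun=> True) c by [].
move: c; apply: chain_ind => [|c d [k ->] [l ->]|[] _].
- by exists 0; rewrite scale0r.
- by exists (k - l); rewrite scalerBl.
- by exists 1; rewrite scale1r.
Qed.

Definition const_simplex (x : X) m : asimplex R X m :=
  match m with 0 => tt | n.+1 => cst x : singular_simplex R X n end.

Lemma bd_const_simplex x m :
  bd << const_simplex x m >> = (\sum_(i < m) (-1) ^+ i) *: << const_simplex x m.-1 >>.
Proof.
rewrite bd1 /bd_simplex scaler_suml; apply: eq_bigr => i _.
case: m i => [[//]|[//|n]] i; congr (_ *: << _ >>).
exact/continuousEP.
Qed.

Lemma alternating_sum m : \sum_(i < m) (-1) ^+ i = (odd m)%:R :> int.
Proof.
elim: m => [|m IHm]; first by rewrite big_ord0.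
by rewrite big_ord_recr /= IHm -signr_odd; case: (odd m).
Qed.

(** The faces of a constant simplex are all equal, so parity decides: for odd [m] only zero is a
    cycle, and for even [m] the constant simplex is the boundary of the next one. *)
Lemma vanish_point (x : X) m : vanish R m [set x].
Proof.
move=> c cx.
have [k -> {c cx}] : exists k : int, c = k *: << const_simplex x m >>.
  move: c cx; apply: chain_ind => [|c d [k ->] [l ->]|s sx].
  - by exists 0; rewrite scale0r.
  - by exists (k - l); rewrite scalerBl.
  - exists 1; rewrite scale1r; congr << _ >>.
    case: m s sx => [[] //|n] s sx; apply/continuousEP => t; exact: sx.
have sE : k *: << const_simplex x m >> = << const_simplex x m >> *~ k.
  by rewrite -scaler_int intz.
rewrite sE raddfMz /= bd_const_simplex alternating_sum.
case: (boolP (odd m)) => om.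
  rewrite scale1r => /eqP; rewrite freegU_mulz freegU_eq0 intz => /eqP k0.
  exists 0; first exact: chain_on0.
  by rewrite raddf0 k0 mulr0z.
move=> _; exists (<< const_simplex x m.+1 >> *~ k).
  by rewrite -scaler_int; apply: chain_onZ; apply: chain_on1.
by rewrite raddfMz /= bd_const_simplex alternating_sum /= om scale1r.
Qed.

Lemma vanish0 (A : set X) : A !=set0 -> vanish R 0 A.
Proof.
move=> [x Ax] c _ _; have [k ->] := chain0E c.
exists (k *: << const_simplex x 1 >>); first by apply: chain_onZ; apply: chain_on1.
rewrite -[k]intz !scaler_int raddfMz /= bd_const_simplex alternating_sum scale1r.
by [].
Qed.

(** A filling of the empty simplex is a nonzero chain, so it contains a 0-simplex, whose value is a
    point of [A]. *)
Lemma vanish0_neq0 (A : set X) : vanish R 0 A -> A !=set0.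
Proof.
move=> /(_ << tt : asimplex R X 0 >>)[||b bA bE].
- by move=> [].
- by rewrite bd1 /bd_simplex big_ord0.
have [b0|] := eqVneq b 0.
  by move: bE => /eqP; rewrite b0 raddf0 eq_sym freegU_eq0.
rewrite -dom_eq0; case E : (dom b) => [//|s l] _.
have sb : s \in dom b by rewrite E mem_head.
by exists ((s : singular_simplex R X 0) (vertex0 R 0)); exact: (bA s sb).
Qed.

Lemma vanish_contractible (A : set X) (q : X) (F : X * R -> X) m : A q ->
  simplexwise_continuous R (cylinder A) F -> (forall p, cylinder A p -> A (F p)) ->
  (forall x, A x -> F (x, 0) = x) -> (forall x, A x -> F (x, 1) = q) ->
  vanish R m A.
Proof.
move=> Aq cF FA F0 F1.
apply: (@vanish_dominated R X X A [set q] (fun=> q) id F m) => //.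
- by move=> n h _ _; exact: cont_cst.
- by move=> _ ->.
- exact: vanish_point.
Qed.

End Contractible.

Section Spheres.
Variables (R : realType) (N : nat).
Local Notation X := 'rV[R]_N.+1.
Implicit Types (x y p : X).

Definition sqnorm x : R := \sum_i x ord0 i ^+ 2.

(* All the spheres live in the same space, so that the induction on [d] only
   involves deformations. *)
Definition sub_sphere d : set X :=
  [set x | sqnorm x = 1 /\ forall i : 'I_N.+1, (d < i)%N -> x ord0 i = 0].

Definition normalize x : X := (Num.sqrt (sqnorm x))^-1 *: x.

Lemma sqnorm_ge0 x : 0 <= sqnorm x.
Proof. by apply: sumr_ge0 => i _; exact: sqr_ge0. Qed.

Lemma sqnormZ k x : sqnorm (k *: x) = k ^+ 2 * sqnorm x.
Proof. by rewrite /sqnorm mulr_sumr; apply: eq_bigr => i _; rewrite mxE exprMn. Qed.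

Lemma sqnorm_eq0 x : (sqnorm x == 0) = (x == 0).
Proof.
apply/idP/eqP => [|->]; last by rewrite -(scale0r 0) sqnormZ expr0n mul0r.
rewrite psumr_eq0 => [/allP x0|i _]; last exact: sqr_ge0.
apply/rowP => i; rewrite mxE; apply/eqP; rewrite -sqrf_eq0.
by apply: x0; rewrite mem_index_enum.
Qed.

Lemma sqrt_sqnorm_gt0 x : x != 0 -> 0 < Num.sqrt (sqnorm x).
Proof. by move=> x0; rewrite sqrtr_gt0 lt0r sqnorm_eq0 x0 sqnorm_ge0. Qed.

Lemma sqnorm_normalize x : x != 0 -> sqnorm (normalize x) = 1.
Proof.
move=> x0; rewrite sqnormZ exprVn sqr_sqrtr ?sqnorm_ge0 // mulVf //.
by rewrite sqnorm_eq0.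
Qed.

Lemma normalize_id x : sqnorm x = 1 -> normalize x = x.
Proof. by move=> x1; rewrite /normalize x1 sqrtr1 invr1 scale1r. Qed.

Lemma sub_sphere_neq0 d x : sub_sphere d x -> x != 0.
Proof. by case=> x1 _; rewrite -sqnorm_eq0 x1 oner_neq0. Qed.

Lemma sqnormN x : sqnorm (- x) = sqnorm x.
Proof. by rewrite -scaleN1r sqnormZ sqrrN expr1n mul1r. Qed.

Lemma sub_sphereN d x : sub_sphere d x -> sub_sphere d (- x).
Proof. by move=> [x1 x0]; split=> [|i di]; rewrite ?sqnormN // mxE x0 ?oppr0. Qed.

Lemma normalize_continuous (T : topologicalType) (f : T -> X) :
  continuous f -> (forall t, f t != 0) -> continuous (fun t => normalize (f t)).
Proof.
move=> cf f0; apply: contZ => //; apply: contV => [|t]; last first.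
  by rewrite gt_eqF // sqrt_sqnorm_gt0.
apply: (cont_comp (g := @Num.sqrt R)); last exact: sqrt_continuous.
by apply: cont_sum => i; apply: contM; apply: cont_coord.
Qed.

Lemma sphere_collinear d x p a b : sub_sphere d x -> sub_sphere d p -> x != p ->
  0 <= a -> 0 <= b -> a *: x = b *: p -> a = 0 /\ b = 0.
Proof.
move=> [x1 _] [p1 _] xp a0 b0 e.
have ab : a = b.
  have /eqP := f_equal sqnorm e; rewrite !sqnormZ x1 p1 !mulr1.
  by rewrite eqrXn2 // => /eqP.
move: e; rewrite -ab => /eqP; rewrite -subr_eq0 -scalerBr scaler_eq0 subr_eq0.
by rewrite (negbTE xp) orbF => /eqP.
Qed.

(** The normalized segment from [x] to [- p] contracts the punctured sphere. By [sphere_collinear]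
    it meets neither the origin nor, after normalization, [p]: both would make [x] and [p]
    positively collinear. *)
Lemma vanish_punctured_sphere d p m : sub_sphere d p ->
  vanish R m (sub_sphere d `&` ~` [set p]).
Proof.
move=> Sp; pose G (q : X * R) := (1 - q.2) *: q.1 - q.2 *: p.
have G0 q : cylinder (sub_sphere d `&` ~` [set p]) q -> G q != 0.
  move=> [[Sq /eqP qp] /andP[q0 q1]]; apply/negP; rewrite subr_eq0 => /eqP e.
  have [|a0 b0] := sphere_collinear Sq Sp qp _ q0 e; first by rewrite subr_ge0.
  by move: a0; rewrite b0 subr0 => /eqP; rewrite oner_eq0.
apply: (@vanish_contractible R X _ (- p) (fun q => normalize (G q))).
- split; first exact: sub_sphereN.
  move=> /= /eqP; rewrite eq_sym -addr_eq0 -mulr2n -scaler_nat scaler_eq0 pnatr_eq0 /=.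
  by rewrite (negbTE (sub_sphere_neq0 Sp)).
- move=> n h ch hC; apply: normalize_continuous => [|t]; last exact/G0/hC.
  apply: contB; apply: contZ.
  + by apply: contB; [exact: cont_cst|exact: cont_snd].
  + exact: cont_fst.
  + exact: cont_snd.
  + exact: cont_cst.
- move=> q qC; have Gq := G0 q qC; have [[Sq /eqP qp] /andP[q0 q1]] := qC.
  split; first split; first exact: sqnorm_normalize.
    move=> i di; case: (Sq) => _ /(_ i di) qi; case: (Sp) => _ /(_ i di) pi.
    by rewrite !mxE qi pi !mulr0 subrr mulr0.
  move=> /= e.
  have : (1 - q.2) *: q.1 = (Num.sqrt (sqnorm (G q)) + q.2) *: p.
    rewrite [RHS]scalerDl -{1}e /normalize scalerA divff ?gt_eqF ?sqrt_sqnorm_gt0 // scale1r.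
    by rewrite subrK.
  case/(sphere_collinear Sq Sp qp) => [||_ /eqP].
  + by rewrite subr_ge0.
  + by rewrite addr_ge0 ?sqrtr_ge0.
  by rewrite gt_eqF // ltr_pwDl // sqrt_sqnorm_gt0.
- by move=> x [[x1 _] _]; rewrite /G /= subr0 scale1r scale0r subr0 normalize_id.
- move=> x _; rewrite /G /= subrr scale0r sub0r scale1r normalize_id //.
  by rewrite sqnormN; case: Sp.
Qed.

Definition axis d : X := delta_mx ord0 (inord d).

Lemma sub_sphere_axis d : (d <= N)%N -> sub_sphere d (axis d).
Proof.
move=> dN; have vd : (inord d : 'I_N.+1) = d :> nat by rewrite inordK.
split=> [|i di].
  rewrite /sqnorm (bigD1 (inord d)) //= mxE !eqxx expr1n big1 ?addr0 // => i id.
  by rewrite mxE (negbTE id) andbF expr0n.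
have /negbTE ni : i != inord d by rewrite -val_eqE /= vd gtn_eqF.
by rewrite mxE ni andbF.
Qed.

Lemma sub_sphereS d x : sub_sphere d x -> sub_sphere d.+1 x.
Proof. by move=> [x1 x0]; split=> // i /ltnW; apply: x0. Qed.

Lemma off_axis d x : sub_sphere d x -> (d <= N)%N -> x != axis d -> x != - axis d ->
  exists2 i, i != inord d & x ord0 i != 0.
Proof.
move=> [x1 _] dN xe xNe; apply: contrapT => H.
have x0 i : i != inord d -> x ord0 i = 0.
  by move=> id; apply/eqP/negPn/negP => xi; apply: H; exists i.
have xE : x = x ord0 (inord d) *: axis d.
  apply/rowP => i; rewrite !mxE eqxx; have [->|id] := eqVneq i (inord d).
    by rewrite mulr1.
  by rewrite mulr0; exact: x0.
have : x ord0 (inord d) ^+ 2 = 1.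
  have [a1 _] := sub_sphere_axis dN.
  by have := f_equal sqnorm xE; rewrite sqnormZ x1 a1 mulr1 => <-.
move=> /eqP; rewrite sqrf_eq1 => /orP[] /eqP xd; move: xE; rewrite xd ?scale1r ?scaleN1r.
  by move/eqP; rewrite (negbTE xe).
by move/eqP; rewrite (negbTE xNe).
Qed.

(** Shrinking the last coordinate and normalizing deforms the sphere without its poles onto the
    equator. Off the poles some other coordinate is nonzero, and it remains so. *)
Lemma vanish_sphere_poles d m : (d < N)%N -> vanish R m (sub_sphere d) ->
  vanish R m (sub_sphere d.+1 `&` (~` [set axis d.+1] `&` ~` [set - axis d.+1])).
Proof.
move=> dN; set A := _ `&` _.
pose i0 : 'I_N.+1 := inord d.+1; have vi0 : i0 = d.+1 :> nat by rewrite inordK.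
pose G (q : X * R) := q.1 - (q.2 * q.1 ord0 i0) *: axis d.+1.
have Gi q i : i != i0 -> G q ord0 i = q.1 ord0 i.
  by move=> ii0; rewrite !mxE (negbTE ii0) andbF mulr0 subr0.
have Gi0 q : G q ord0 i0 = (1 - q.2) * q.1 ord0 i0.
  by rewrite !mxE !eqxx mulr1 mulrBl mul1r.
have AE x : A x -> exists2 i, i != i0 & x ord0 i != 0.
  by case=> Sx [/eqP xe /eqP xNe]; apply: off_axis Sx _ xe xNe.
have AI x : sub_sphere d.+1 x -> (exists2 i, i != i0 & x ord0 i != 0) -> A x.
  move=> Sx [i ii0 xi]; split=> //; split=> /= xe; move: xi; rewrite xe !mxE (negbTE ii0).
    by rewrite andbF eqxx.
  by rewrite andbF oppr0 eqxx.
have G0 q : cylinder A q -> G q != 0.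
  move=> [/AE[i ii0 qi] _]; apply: contra_neq qi => /rowP/(_ i).
  by rewrite Gi // mxE.
have FS q : cylinder A q -> sub_sphere d.+1 (normalize (G q)).
  move=> qA; split; first exact/sqnorm_normalize/G0.
  move=> i di; rewrite mxE Gi; last by rewrite -val_eqE /= vi0 gtn_eqF.
  by case: qA => -[[_ ->]]; rewrite ?mulr0.
have Fi q i : cylinder A q -> i != i0 -> q.1 ord0 i != 0 -> normalize (G q) ord0 i != 0.
  move=> qA ii0 qi; rewrite mxE Gi // mulf_neq0 // invr_neq0 // gt_eqF //.
  exact/sqrt_sqnorm_gt0/G0.
have cF : simplexwise_continuous R (cylinder A) (fun q => normalize (G q)).
  move=> n h ch hC; apply: normalize_continuous => [|t]; last exact/G0/hC.
  apply: contB; first exact: cont_fst.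
  apply: contZ; last exact: cont_cst.
  by apply: contM; [exact: cont_snd|apply: cont_coord; exact: cont_fst].
have cyl1 x : A x -> cylinder A (x, 1 : R) by split=> //=; rewrite ler01 lexx.
apply: (vanish_dominated (F := fun q => normalize (G q))
  (f := fun x => normalize (G (x, 1)))
  (g := id)) => //.
- move=> n h ch hA; apply: (cF n (fun t => (h t, 1))).
    by apply: cont_pair => //; exact: cont_cst.
  by move=> t; apply: cyl1.
- move=> x Ax; have [s1 s0] := FS _ (cyl1 x Ax); split=> // i.
  rewrite leq_eqVlt => /orP[/eqP di|].
    have -> : i = i0 by apply: val_inj; rewrite /= vi0.
    by rewrite mxE Gi0 subrr mul0r mulr0.
  exact: s0.
- move=> x Sx; apply: AI; first exact: sub_sphereS.
  have : x != 0 by exact: sub_sphere_neq0 Sx.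
  move=> x0; apply: contrapT => H; move/negP: x0; apply; apply/eqP/rowP => i; rewrite mxE.
  have [->|ii0] := eqVneq i i0; first by case: Sx => _ ->; rewrite ?vi0.
  by apply/eqP/negPn/negP => xi; apply: H; exists i.
- move=> q qA; apply: AI; first exact: FS.
  by case: (qA) => /AE[i ii0 qi] _; exists i => //; exact: Fi.
- move=> x [[x1 _] _]; rewrite /G /= mul0r scale0r subr0; exact: normalize_id.
Qed.

(** Suspension: the sphere is covered by the complements of its two poles, whose intersection
    retracts to the equator. With the shift of [vanish], [m <= d] means degrees below [d]. *)
Lemma vanish_sub_sphere d m : (d <= N)%N -> (m <= d)%N -> vanish R m (sub_sphere d).
Proof.
elim: d m => [|d IHd] m dN.
  rewrite leqn0 => /eqP->; apply: vanish0; exists (axis 0); exact: sub_sphere_axis.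
case: m => [_|m md].
  by apply: vanish0; exists (axis d.+1); exact: sub_sphere_axis.
have o1 (x : X) : open (~` [set x]).
  apply: closed_openC; apply: accessible_closed_set1.
  exact/hausdorff_accessible/norm_hausdorff.
have Sa := sub_sphere_axis dN.
apply: (@vanish_setU R X (~` [set axis d.+1]) (~` [set - axis d.+1])) => //.
- move=> x _; have [->|/eqP] := eqVneq x (axis d.+1); [right|by left].
  move=> /= /eqP; rewrite -addr_eq0 -mulr2n -scaler_nat scaler_eq0 pnatr_eq0 /=.
  by rewrite (negbTE (sub_sphere_neq0 Sa)).
- by apply: vanish_sphere_poles => //; apply: IHd => //; exact: ltnW.
- exact: vanish_punctured_sphere.
- exact/vanish_punctured_sphere/sub_sphereN.
Qed.

End Spheres.

(** * Realizations of finite complexes *)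

Section RealizationTopology.
Variables (R : realType) (V : choiceType).
Implicit Types (L : simplicial_complex V) (s : {fset V}).

Lemma ptws_eval_continuous (v : V) : continuous (fun x : {ptws V -> R} => x v).
Proof. exact: (@proj_continuous V (fun=> R) v). Qed.

Lemma ptws_continuous (T : topologicalType) (f : T -> {ptws V -> R}) :
  (forall v, continuous (fun t => f t v)) -> continuous f.
Proof.
move=> cf t; apply/cvg_sup => v; apply/cvg_image.
  by rewrite eqEsubset; split => y // _; exists (fun=> y).
move=> W /(cf v t) Wv; exists [set g : {ptws V -> R} | W (g v)] => //.
by rewrite eqEsubset; split=> [_ [g Wg <-]//|y Wy]; exists (fun=> y).
Qed.

Lemma bary_continuous L v : continuous (fun x : realization R L => bary x v).
Proof.
apply/continuousP => A oA.
suff : realization_open ((fun x : realization R L => bary x v) @^-1` A) by [].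
move=> s Ls; exists [set x : {ptws V -> R} | A (x v)] => //.
apply: (@open_comp _ _ (fun x : {ptws V -> R} => x v) A) => // x _.
exact: ptws_eval_continuous.
Qed.

Lemma closed_simplex_closed s : closed (closed_simplex R s).
Proof.
rewrite (_ : closed_simplex R s =
    (\bigcap_v [set x : {ptws V -> R} | 0 <= x v]) `&`
    ((\bigcap_(v in [set v | v \notin s]) [set x : {ptws V -> R} | x v = 0]) `&`
     [set x : {ptws V -> R} | \sum_(v <- s) x v = 1])).
  apply: closedI; last apply: closedI.
  - apply: closed_bigI => v _.
    apply: (@preimage_closed _ _ (fun x : {ptws V -> R} => x v) [set x | 0 <= x]).
      by move=> x _; exact: ptws_eval_continuous.
    exact: closed_ge.
  - apply: closed_bigI => v _.
    apply: (@preimage_closed _ _ (fun x : {ptws V -> R} => x v) [set x | x = 0]).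
      by move=> x _; exact: ptws_eval_continuous.
    exact: closed_eq.
  apply: (@preimage_closed _ _ (fun x : {ptws V -> R} => \sum_(v <- s) x v) [set x | x = 1]).
    by move=> x _; move: x; apply: cont_sum => v; exact: ptws_eval_continuous.
  exact: closed_eq.
apply/seteqP; split=> x.
  by move=> [x0 xs x1]; split=> [v _|]; [exact: x0|split].
move=> [x0 [xs x1]]; split=> // v; exact: x0.
Qed.

Lemma realization_eq L (x y : realization R L) : bary x = bary y -> x = y.
Proof.
case: x y => [x px] [y py] /= xy; rewrite xy in px *.
by congr Realization; exact: Prop_irrelevance.
Qed.

Lemma open_seq_all (T : topologicalType) (I : eqType) (l : seq I) (P : I -> set T) :
  (forall i, open (P i)) -> open [set x | {in l, forall i, P i x}].
Proof.
move=> oP; elim: l => [|i l IHl].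
  by rewrite (_ : mkset _ = setT); [exact: openT|apply/seteqP; split].
rewrite (_ : mkset _ = P i `&` [set x | {in l, forall i, P i x}]); first exact: openI.
apply/seteqP; split=> x.
  by move=> xP; split=> [|j jl]; apply: xP; rewrite inE ?eqxx ?jl ?orbT.
by move=> [xi xl] j; rewrite inE => /orP[/eqP->|/xl].
Qed.

Definition finite_faces L := exists D : {fset {fset V}}, forall s, L s -> s \in D.

Lemma finite_vertices L : finite_faces L ->
  exists N : {fset V}, forall s, L s -> (s `<=` N)%fset.
Proof.
move=> [D LD]; exists (\bigcup_(s <- D) s)%fset => s /LD sD.
exact: (bigfcup_sup _ sD).
Qed.

(** With finitely many faces the weak topology is induced by the coordinates: an open set is the
    finite intersection, over the faces [s], of its trace [W s] enlarged by the open complement of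
    the closed simplex. *)
Lemma realization_continuous L (T : topologicalType) (f : T -> realization R L) :
  finite_faces L -> (forall v, continuous (fun t => bary (f t) v)) -> continuous f.
Proof.
move=> [D LD] cf; apply/continuousP => U oU.
have /choice[W WP] s : exists W : set {ptws V -> R}, open W /\
    forall x : realization R L, L s -> closed_simplex R s x -> (U x <-> W x).
  have [Ls|nLs] := pselect (L s).
    by have [W oW WU] := oU s Ls; exists W; split=> // x _; exact: WU.
  by exists setT; split=> [|x /nLs //]; exact: openT.
pose P s := W s `|` ~` closed_simplex R s.
have oP s : open (P s).
  apply: openU; first by case: (WP s).
  exact/closed_openC/closed_simplex_closed.
have UE x : U x <-> {in [seq s <- D | `[< L s >]], forall s, P s x}.
  split=> [Ux s|xP].
    rewrite mem_filter => /andP[/asboolP Ls _].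
    have [xs|] := pselect (closed_simplex R s x); [left|by right].
    by apply/(proj2 (WP s) x Ls xs).
  have [s Ls xs] := bary_closed_simplex x.
  apply/(proj2 (WP s) x Ls xs); have [] // := xP s _.
  by rewrite mem_filter LD // andbT; apply/asboolP.
rewrite (_ : f @^-1` U = (fun t => bary (f t)) @^-1`
    [set x | {in [seq s <- D | `[< L s >]], forall s, P s x}]); last first.
  by apply/seteqP; split=> t /UE.
apply: open_comp; last exact: open_seq_all.
by move=> t _; exact: ptws_continuous.
Qed.

Lemma realization_sub1 L (N : {fset V}) (x : realization R L) :
  (forall s, L s -> (s `<=` N)%fset) -> \sum_(v <- N) bary x v = 1.
Proof.
move=> LN; have [s Ls [_ xs <-]] := bary_closed_simplex x.
by rewrite (big_fset_incl _ (LN s Ls)) // => v _; apply: xs.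
Qed.

Lemma bary_ge0 L (x : realization R L) v : 0 <= bary x v.
Proof. by have [s _ []] := bary_closed_simplex x. Qed.

Definition barycenter s : {ptws V -> R} := fun v => if v \in s then (#|` s|)%:R^-1 else 0.

Lemma barycenter_gt0 s v : v \in s -> 0 < barycenter s v.
Proof.
rewrite /barycenter => vs; rewrite vs invr_gt0 ltr0n cardfs_gt0.
by apply/fset0Pn; exists v.
Qed.

Lemma barycenter_simplex s : s != fset0 -> closed_simplex R s (barycenter s).
Proof.
move=> s0; split=> [v|v /negbTE vs|]; rewrite /barycenter ?vs //.
  by case: ifP => // _; rewrite invr_ge0 ler0n.
rewrite big_seq (eq_bigr (fun=> (#|` s|)%:R^-1)) => [|v ->//].
rewrite -big_seq big_const_seq count_predT iter_addr addr0 -[_ *+ _]mulr_natr.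
by rewrite mulVf // pnatr_eq0 cardfs_eq0.
Qed.

Lemma barycenter_inj s t : barycenter s = barycenter t -> s = t.
Proof.
move=> st; apply/fsetP => v; apply/idP/idP => vs; have := barycenter_gt0 vs;
  [rewrite st|rewrite -st]; rewrite /barycenter; case: ifP => //; by rewrite ltxx.
Qed.

(** A closed simplex contains the barycenters of its own faces only, so on each simplex finitely
    many conditions remain. *)
Lemma barycenters_avoid_open L (x : realization R L) :
  open [set y : realization R L | forall t, L t -> bary x <> barycenter t ->
    bary y <> barycenter t].
Proof.
move=> s Ls.
pose P t := [set y : {ptws V -> R} | bary x <> barycenter t -> y <> barycenter t].
exists [set y | {in [seq t <- fpowerset s | `[< L t >]], forall t, P t y}].
  apply: open_seq_all => t.
  have [xt|xt] := pselect (bary x = barycenter t).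
    rewrite (_ : P t = setT); first exact: openT.
    by apply/seteqP; split=> y // _ /(_ xt).
  rewrite (_ : P t = \bigcup_v [set y : {ptws V -> R} | y v != barycenter t v]).
    apply: bigcup_open => v _.
    apply: (@open_comp _ _ (fun y : {ptws V -> R} => y v) [set a | a != barycenter t v]).
      by move=> y _; exact: ptws_eval_continuous.
    exact: open_neq.
  apply/seteqP; split=> y; last by move=> [v _ /eqP yv] _ e; apply: yv; rewrite e.
  move=> /(_ xt) yt; apply: contrapT => H; apply: yt; apply/funext => v.
  by apply/eqP/negPn/negP => yv; apply: H; exists v.
move=> y ys; split=> [H t|H t Lt xt e].
  by rewrite mem_filter => /andP[/asboolP Lt _] xt; exact: H.
apply: (H t) => //; rewrite mem_filter fpowersetE; apply/andP; split; first exact/asboolP.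
apply/fsubsetP => v vt; case: ys => _ ys _; apply: contraT => /ys.
by rewrite e => v0; have := barycenter_gt0 vt; rewrite v0 ltxx.
Qed.

(* The barycenters of the faces form a closed discrete set. *)
Lemma compact_finite_faces L : compact [set: realization R L] -> finite_faces L.
Proof.
(* The near-covering form of compactness is used with the filter of large finite sets of faces: one
   finite set that works locally around each point gives one that works globally. *)
move=> /compact_near_coveringP/(_ {fset {fset V}}
  (filter_from setT (fun D0 : {fset {fset V}} => [set D | (D0 `<=` D)%fset]))
  (fun D (x : realization R L) => forall t, L t -> bary x = barycenter t -> t \in D)) H.
have/H{H} : Filter
    (filter_from setT (fun D0 : {fset {fset V}} => [set D | (D0 `<=` D)%fset])).
  apply: filter_from_filter; first by exists fset0.
  move=> D1 D2 _ _; exists (D1 `|` D2)%fset => // D /=.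
  by rewrite fsubUset => /andP[].
move=> H; have {H}[x _|D _ /(_ D (fsubset_refl D)) DP] := H; last first.
  exists D => s Ls.
  pose b : realization R L := Realization
    (ex_intro2 _ _ s Ls (barycenter_simplex (face_neq0 Ls))).
  exact: (DP b).
have [D0 D0P] : exists D0 : {fset {fset V}}, forall t, bary x = barycenter t -> t \in D0.
  have [[t xt]|nt] := pselect (exists t, bary x = barycenter t).
    by exists [fset t]%fset => t'; rewrite xt inE => /barycenter_inj->.
  by exists fset0 => t xt; case: nt; exists t.
exists ([set y : realization R L | forall t, L t -> bary x <> barycenter t ->
    bary y <> barycenter t], [set D | (D0 `<=` D)%fset]) => /=.
  split; last by exists D0.
  by apply: open_nbhs_nbhs; split; first exact: barycenters_avoid_open.
move=> [y D] [/= yx DD] t Lt yt; apply: (fsubsetP DD); apply: D0P.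
by apply: contrapT => xt; exact: (yx t Lt xt yt).
Qed.

End RealizationTopology.

Section RealPoint.
Variables (R : realType) (V : choiceType) (L : simplicial_complex V).

(** The default [x0] makes maps that are given by their coordinates total. *)
Definition real_point (x0 : realization R L) (y : {ptws V -> R}) : realization R L :=
  match pselect (exists2 s, L s & closed_simplex R s y) with
  | left p => Realization p
  | right _ => x0
  end.

Lemma real_pointE x0 y : (exists2 s, L s & closed_simplex R s y) ->
  bary (real_point x0 y) = y.
Proof. by rewrite /real_point; case: pselect. Qed.

Lemma closed_simplex_normalize (N s : {fset V}) (z : {ptws V -> R}) : (s `<=` N)%fset ->
  (forall v, 0 <= z v) -> (forall v, v \notin s -> z v = 0) -> \sum_(v <- N) z v != 0 ->
  closed_simplex R s (fun v => z v / \sum_(u <- N) z u).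
Proof.
move=> sN z0 zs zN; split=> [v|v /zs->|]; last 2 first.
- by rewrite mul0r.
- rewrite -mulr_suml (big_fset_incl _ sN) ?divff // => v _; exact: zs.
by rewrite divr_ge0 // sumr_ge0.
Qed.

End RealPoint.

(** * Unions of nonmaximality sets *)

Section StarComplements.
Variables (R : realType) (V : choiceType) (K : simplicial_complex V).
Variable N : {fset V}.
Hypotheses (finK : finite_faces K) (KN : forall s, K s -> (s `<=` N)%fset).
Local Notation X := (realization R K).
Implicit Types (x : X) (v w u : V) (W : {fset V}).

Lemma bary_sum x : \sum_(v <- N) bary x v = 1.
Proof. exact: realization_sub1. Qed.

Lemma bary_pos x : exists2 v, v \in N & 0 < bary x v.
Proof.
apply: contrapT => H; have /eqP := bary_sum x.
rewrite big_seq big1 => [|v vN]; first by rewrite eq_sym oner_eq0.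
by apply/eqP; rewrite eq_le bary_ge0 andbT leNgt; apply/negP => xv; apply: H; exists v.
Qed.

Definition nonmaximal W : set X :=
  [set x | exists2 w, w \in W & exists u, bary x w < bary x u].

Lemma nonmaximal_open W : open (nonmaximal W).
Proof.
rewrite (_ : nonmaximal W = \bigcup_(w in [set w | w \in W])
    \bigcup_u ((fun x : X => bary x u - bary x w) @^-1` [set r | 0 < r])).
  apply: bigcup_open => w _; apply: bigcup_open => u _; apply: open_comp; last exact: open_gt.
  move=> x _; move: x; apply: contB; exact: bary_continuous.
apply/seteqP; split=> x.
  by move=> [w wW [u wu]]; exists w => //; exists u => //=; rewrite subr_gt0.
by move=> [w wW [u _ /=]]; rewrite subr_gt0 => wu; exists w => //; exists u.
Qed.

Lemma nonmaximalU W W' : nonmaximal W `|` nonmaximal W' = nonmaximal (W `|` W')%fset.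
Proof.
apply/seteqP; split=> x.
  by move=> [] [w wW wu]; exists w => //; rewrite inE wW ?orbT.
by move=> [w]; rewrite inE => /orP[] wW wu; [left|right]; exists w.
Qed.

(** At a point where all coordinates in [W] are maximal they are positive, so [W] is contained in a
    face. *)
Lemma nonmaximal_nonface W : W != fset0 -> ~ K W -> nonmaximal W = setT.
Proof.
move=> W0 nKW; apply/seteqP; split=> // x _; apply: contrapT => H; apply: nKW.
have xW w u : w \in W -> bary x u <= bary x w.
  by move=> wW; rewrite leNgt; apply/negP => wu; apply: H; exists w => //; exists u.
have [u _ u0] := bary_pos x; have [s Ks [_ xs _]] := bary_closed_simplex x.
apply: (face_sub Ks) => //; apply/fsubsetP => w wW; apply: contraT => /xs w0.
by have := lt_le_trans u0 (xW w u wW); rewrite w0 ltxx.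
Qed.

Section Face.
Variable W : {fset V}.
Hypothesis KW : K W.

Definition face_center : X :=
  Realization (ex_intro2 _ _ W KW (barycenter_simplex R (face_neq0 KW))).

(** Keeps [damping] positive at the points of the simplex [W] other than its center, where
    [off_face] vanishes. *)
Definition spread x : R := \sum_(w <- W) \sum_(u <- W) `|bary x w - bary x u|.
(** The squares provide the extra factor on which the last estimate of [damp_nonmaximal] rests. *)
Definition off_face x : R := \sum_(u <- N | u \notin W) bary x u ^+ 2.
Definition damping x : R := off_face x + spread x.

(* A deformation which pushes the points away from the center of [W]: at time 1
   the coordinates in [W] are multiplied by [damping], before normalization.  The
   factor vanishes at the center only, and on the points where the coordinates in
   [W] are equal it is so small that these no longer are maximal. *)
Definition damped (p : X * R) v : R :=
  (if v \in W then 1 - p.2 + p.2 * damping p.1 else 1) * bary p.1 v.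
Definition damp (p : X * R) : X :=
  real_point p.1 (fun v => damped p v / \sum_(u <- N) damped p u).

Lemma off_face_ge0 x : 0 <= off_face x.
Proof. by apply: sumr_ge0 => u _; exact: sqr_ge0. Qed.

Lemma spread_ge0 x : 0 <= spread x.
Proof. by apply: sumr_ge0 => w _; apply: sumr_ge0 => u _; exact: normr_ge0. Qed.

Lemma spread_eq0 x : (forall w u, w \in W -> u \in W -> bary x w = bary x u) ->
  spread x = 0.
Proof.
move=> xW; rewrite /spread big_seq big1 // => w wW; rewrite big_seq big1 // => u uW.
by rewrite (xW w u) // subrr normr0.
Qed.

Lemma bary_off_face x w : w \in W ->
  bary x w + \sum_(u <- N | u \notin W) bary x u <= 1.
Proof.
move=> wW; rewrite -(bary_sum x) [leRHS](bigID (fun v => v \in W)) /= lerD2r.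
have wN : w \in enum_fset N by exact: (fsubsetP (KN KW)).
rewrite big_mkcond (bigD1_seq w) //= wW lerDl.
by apply: sumr_ge0 => u _; case: ifP => // _; exact: bary_ge0.
Qed.

Lemma damping_eq0 x : damping x = 0 -> x = face_center.
Proof.
move=> /eqP; rewrite paddr_eq0 ?off_face_ge0 ?spread_ge0 // => /andP[q0 d0].
have W0 := face_neq0 KW; have /fset0Pn[w0 w0W] := W0.
have xW w : w \in W -> bary x w = bary x w0.
  move=> wW; move: d0; rewrite psumr_eq0; last by move=> *; apply: sumr_ge0.
  move=> /allP/(_ w wW)/=; rewrite psumr_eq0 // => /allP/(_ w0 w0W)/=.
  by rewrite normr_eq0 subr_eq0 => /eqP.
have xnW u : u \notin W -> bary x u = 0.
  move=> uW; have [uN|uN] := boolP (u \in N); last first.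
    have [s Ks [_ xs _]] := bary_closed_simplex x; apply: xs.
    by apply: contra uN => /(fsubsetP (KN Ks)).
  move: q0; rewrite psumr_eq0; last by move=> *; exact: sqr_ge0.
  by move=> /allP/(_ u uN); rewrite uW /= sqrf_eq0 => /eqP.
apply: realization_eq; apply/funext => v /=; rewrite /barycenter.
case: ifP => [vW|/negbT/xnW//]; rewrite xW //.
have : \sum_(v <- W) bary x v = 1.
  by rewrite (big_fset_incl _ (KN KW)) ?bary_sum // => u _; exact: xnW.
rewrite big_seq (eq_bigr _ xW) -big_seq big_const_seq count_predT iter_addr addr0.
move=> x1; apply: (mulIf (x := (#|` W|)%:R)); first by rewrite pnatr_eq0 cardfs_eq0.
by rewrite mulVf ?pnatr_eq0 ?cardfs_eq0 // mulr_natr.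
Qed.

Lemma damping_gt0 x : x <> face_center -> 0 < damping x.
Proof.
move=> xb; rewrite lt_neqAle addr_ge0 ?off_face_ge0 ?spread_ge0 // andbT.
by apply/eqP => a0; apply/xb/damping_eq0.
Qed.

Lemma nonmaximal_center x : nonmaximal W x -> x <> face_center.
Proof.
move=> [w wW [u xwu]] xb; move: xwu; rewrite xb /= /barycenter wW.
by case: ifP => _; rewrite ?ltxx // ltNge invr_ge0 ler0n.
Qed.

Section Damp.
Variable p : X * R.
Hypotheses (p01 : 0 <= p.2 <= 1) (a0 : 0 < damping p.1).

Lemma damping_factor_gt0 : 0 < 1 - p.2 + p.2 * damping p.1.
Proof.
case/andP: p01 => p0 p1; move: p0; rewrite le_eqVlt => /orP[/eqP<-|p0].
  by rewrite subr0 mul0r addr0.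
by rewrite ltr_wpDl ?subr_ge0 // mulr_gt0.
Qed.

Lemma damped_ge0 v : 0 <= damped p v.
Proof.
by rewrite mulr_ge0 ?bary_ge0 //; case: ifP => // _; apply/ltW/damping_factor_gt0.
Qed.

Lemma damped_sum_gt0 : 0 < \sum_(v <- N) damped p v.
Proof.
have [v vN v0] := bary_pos p.1.
rewrite (bigD1_seq v) //= ltr_wpDr //; first by apply: sumr_ge0 => u _; exact: damped_ge0.
by rewrite mulr_gt0 //; case: ifP => // _; exact: damping_factor_gt0.
Qed.

Lemma bary_damp : bary (damp p) = fun v => damped p v / \sum_(u <- N) damped p u.
Proof.
apply: real_pointE; have [s Ks [_ xs _]] := bary_closed_simplex p.1.
exists s => //; apply: closed_simplex_normalize; first exact: KN.
- exact: damped_ge0.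
- by move=> v /xs; rewrite /damped => ->; rewrite mulr0.
- by rewrite gt_eqF // damped_sum_gt0.
Qed.

Lemma damp_nonmaximal : nonmaximal W p.1 \/ p.2 = 1 -> nonmaximal W (damp p).
Proof.
move=> xp; suff [w wW [u wu]] : exists2 w, w \in W & exists u, damped p w < damped p u.
  exists w => //; exists u; rewrite bary_damp ltr_pM2r // invr_gt0.
  exact: damped_sum_gt0.
(* Coordinates in [W] are all scaled by the same positive factor, so a strict inequality between two
   of them persists. Otherwise they are equal and [damping] reduces to [off_face]. *)
have [[w [u [wW uW wu]]]|H] := pselect (exists w u, [/\ w \in W, u \in W &
    bary p.1 w < bary p.1 u]).
  exists w => //; exists u; rewrite /damped wW uW ltr_pM2l //.
  exact: damping_factor_gt0.
have xW w u : w \in W -> u \in W -> bary p.1 w = bary p.1 u.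
  move=> wW uW; apply/eqP; rewrite eq_le !leNgt.
  apply/andP; split; apply/negP => wu; apply: H.
    by exists u, w.
  by exists w, u.
have aE : damping p.1 = off_face p.1 by rewrite /damping (spread_eq0 xW) addr0.
have /fset0Pn[w0 w0W] := face_neq0 KW.
set r := \sum_(u <- N | u \notin W) bary p.1 u.
have cr : bary p.1 w0 + r <= 1 by exact: bary_off_face.
have r0 : 0 <= r by apply: sumr_ge0 => u _; exact: bary_ge0.
have c0 := bary_ge0 p.1 w0.
case: xp => [[w wW [u wu]]|p1].
  (* The larger coordinate is outside [W] and is not scaled, while those in [W] are scaled by at
     most 1, since [off_face] is at most [r]. *)
  have uW : u \notin W by apply/negP => uW; move: wu; rewrite (xW w u) // ltxx.
  exists w => //; exists u; rewrite /damped wW (negbTE uW) mul1r.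
  apply: le_lt_trans wu; rewrite ler_piMl ?bary_ge0 //.
  suff a1 : damping p.1 <= 1.
    case/andP: p01 => p0 _; rewrite -subr_ge0.
    have -> : 1 - (1 - p.2 + p.2 * damping p.1) = p.2 * (1 - damping p.1).
      by rewrite mulrBr mulr1 opprD opprB addrA addrCA subrr addr0.
    by rewrite mulr_ge0 // subr_ge0.
  rewrite aE; apply: (@le_trans _ _ r); last by apply: le_trans cr; rewrite lerDr.
  rewrite /off_face /r big_seq_cond [leRHS]big_seq_cond.
  apply: ler_sum => v /andP[vN vW].
  rewrite expr2 ler_piMl ?bary_ge0 // -(bary_sum p.1) (bigD1_seq v) //= lerDl.
  by apply: sumr_ge0 => ? _; exact: bary_ge0.
apply: contrapT => H'; have xle u : u \notin W -> bary p.1 u <= off_face p.1 * bary p.1 w0.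
  move=> uW; rewrite leNgt; apply/negP => wu; apply: H'; exists w0 => //; exists u.
  by rewrite /damped w0W (negbTE uW) p1 subrr add0r !mul1r aE.
have q0 : 0 < off_face p.1 by rewrite -aE.
(* With q = [off_face], c the common coordinate in [W] and x_u <= q c off [W], summing x_u ^ 2 <= q
   c x_u gives q <= q c r. Hence c r >= 1, contrary to c + r <= 1. *)
have : off_face p.1 <= off_face p.1 * (bary p.1 w0 * r).
  rewrite mulrA /r mulr_sumr; apply: ler_sum => u uW.
  by rewrite expr2 ler_wpM2r ?bary_ge0 // xle.
rewrite ler_pMr // => cr1.
have : bary p.1 w0 * r <= bary p.1 w0 by rewrite ler_piMr //; lra.
nra.
Qed.

End Damp.

Lemma damp_continuous (B : set (X * R)) :
  (forall p, B p -> 0 <= p.2 <= 1 /\ 0 < damping p.1) ->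
  simplexwise_continuous R B damp.
Proof.
move=> BP n h ch hB; apply: (realization_continuous finK) => v.
rewrite (_ : (fun t => _) =
    fun t => damped (h t) v / \sum_(u <- N) damped (h t) u); last first.
  by apply/funext => t; have [p01 a0] := BP _ (hB t); rewrite bary_damp.
have cb u : continuous (fun t => bary (h t).1 u).
  by apply: (cont_comp (g := fun x : X => bary x u)); [exact: cont_fst|exact: bary_continuous].
have cd : continuous (fun t => damping (h t).1).
  apply: contD; first by apply: cont_sum => u; apply: contM.
  apply: cont_sum => w; apply: cont_sum => u; apply: (cont_norm (V := R)).
  exact: contB.
have cz u : continuous (fun t => damped (h t) u).
  apply: contM => //; case: (u \in W); last exact: cont_cst.
  have c2 : continuous (fun t => (h t).2) by exact: cont_snd.
  by apply: contD; [apply: contB => //; exact: cont_cst|exact: contM].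
apply: contM => //; apply: contV; first exact: cont_sum.
by move=> t; have [p01 a0] := BP _ (hB t); rewrite gt_eqF // damped_sum_gt0.
Qed.

(** The inclusion and the time 1 map of [damp] dominate: the latter carries the whole complement of
    the center into [nonmaximal W], and [damp] preserves [nonmaximal W] at all times. *)
Lemma vanish_nonmaximal_face m :
  vanish R m (~` [set face_center]) -> vanish R m (nonmaximal W).
Proof.
have p1 : 0 <= (1 : R) <= 1 by rewrite ler01 lexx.
apply: (vanish_dominated (F := damp) (f := id) (g := fun x => damp (x, 1))) => //.
- by move=> x /nonmaximal_center.
- move=> n h ch hB; apply: (@damp_continuous (~` [set face_center] `*` [set 1])
    _ n (fun t => (h t, 1))).
  + by move=> [x t] [/= xb ->]; split => //; exact: damping_gt0.
  + by apply: cont_pair => //; exact: cont_cst.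
  + by move=> t; split=> //; exact: hB.
- move=> x xb; apply: damp_nonmaximal => //=; first exact: damping_gt0.
  by right.
- apply: damp_continuous => p [pW p01]; split=> //.
  exact/damping_gt0/nonmaximal_center.
- move=> p [pW p01]; apply: damp_nonmaximal => //; last by left.
  exact/damping_gt0/nonmaximal_center.
move=> x xW; apply: realization_eq.
rewrite bary_damp //=; last 2 first.
- by rewrite lexx ler01.
- exact/damping_gt0/nonmaximal_center.
have zE v : damped (x, 0) v = bary x v.
  by rewrite /damped /= subr0 mul0r addr0; case: ifP => _; rewrite mul1r.
by apply/funext => v; rewrite zE (eq_bigr _ (fun v _ => zE v)) bary_sum divr1.
Qed.

End Face.

Lemma vanish_nonmaximal W m : W != fset0 -> vanish R m [set: X] ->
  (forall x, vanish R m (~` [set x])) -> vanish R m (nonmaximal W).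
Proof.
move=> W0 vT vx; have [KW|nKW] := pselect (K W).
  exact: (vanish_nonmaximal_face (KW := KW)).
by rewrite nonmaximal_nonface.
Qed.

End StarComplements.

(** * Complements of full subcomplexes of a sphere *)

Section Intersections.
Variables (R : realType) (X : topologicalType) (P : set X -> Prop) (e : nat).
Hypotheses (P_open : forall A, P A -> open A)
  (PU : forall A B, P A -> P B -> P (A `|` B))
  (P_vanish : forall A m, P A -> (m <= e)%N -> vanish R m A).

(** The family varies in the induction on [l]: the union with [A i0] distributes over the
    intersection and gives the sets of the family [A i0]|[A i], again in [P] by [PU]. The degree
    lost is paid for by the shorter list. *)
Lemma vanish_bigcap (I : eqType) (i0 : I) (l : seq I) (A : I -> set X) m :
  (forall i, P (A i)) -> (m + size l <= e)%N ->
  vanish R m [set x | {in i0 :: l, forall i, A i x}].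
Proof.
elim: l i0 A m => [|j l IHl] i0 A m PA.
  rewrite addn0 => me; rewrite (_ : mkset _ = A i0); first exact: P_vanish.
  apply/seteqP; split=> x; first by apply; rewrite inE.
  by move=> Ax i; rewrite inE => /eqP->.
rewrite /= addnS => me; pose B := [set x | {in j :: l, forall i, A i x}].
have oB : open B by apply: open_seq_all => i; exact: P_open.
rewrite (_ : mkset _ = (A i0 `|` B) `&` (A i0 `&` B)); last first.
  apply/seteqP; split=> x.
    move=> xA; have xi0 : A i0 x by apply: xA; rewrite inE eqxx.
    by split; [left|split=> // i il; apply: xA; rewrite inE il orbT].
  move=> [_ [xi0 xB]] i; rewrite inE => /orP[/eqP->//|il]; exact: xB.
have vZ : vanish R m.+1 (A i0 `|` B).
  rewrite (_ : _ `|` _ = [set x | {in j :: l, forall i, (A i0 `|` A i) x}]).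
    by apply: (IHl j (fun i => A i0 `|` A i)) => // i; exact: PU.
  apply/seteqP; split=> x.
    by move=> [xi0 i _|xB i il]; [left|right; exact: xB].
  move=> xA; have [xi0|nxi0] := pselect (A i0 x); [by left|right=> i il].
  by case: (xA i il).
apply: vanish_setI => //; first exact: P_open.
- rewrite (_ : _ `&` _ = A i0); last first.
    by apply/seteqP; split=> x; [case|split=> //; left].
  by apply: P_vanish => //; rewrite (leq_trans _ me) // leqW // leq_addr.
rewrite (_ : _ `&` _ = B); last by apply/seteqP; split=> x; [case|split=> //; right].
by apply: IHl => //; exact: ltnW.
Qed.

End Intersections.

Section SphereRealization.
Variables (R : realType) (d : nat) (V : choiceType) (K : simplicial_complex V).
Hypothesis sphereK : simplicial_sphere R d K.
Local Notation X := (realization R K).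

Lemma unit_sphereE : unit_sphere R d = @sub_sphere R d d.
Proof.
apply/seteqP; split=> x; last by case.
by move=> x1; split=> // i; rewrite ltnNge -ltnS ltn_ord.
Qed.

(** The inverse is extended by a constant off the sphere, so that both maps are total, as in the
    lemmas on [vanish]. *)
Lemma sphere_chart : exists (f : X -> 'rV[R]_d.+1) (g : 'rV[R]_d.+1 -> X),
  [/\ continuous f, forall x, unit_sphere R d (f x), cancel f g,
      {in unit_sphere R d, cancel g f} & {within unit_sphere R d, continuous g}].
Proof.
have [f [g [cf cg fK gK]]] := sphereK.
have aS : @axis R d d \in unit_sphere R d.
  by rewrite unit_sphereE inE; exact: sub_sphere_axis.
pose p0 : unit_sphere R d := exist (fun x => x \in unit_sphere R d) _ aS.
exists (fun x => val (f x)), (fun y => g (insubd p0 y)); split.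
- exact: cont_val.
- by move=> x; have /set_mem := valP (f x).
- by move=> x; rewrite valKd.
- by move=> y yS; rewrite gK insubdK.
apply/subspace_sigL_continuousP.
rewrite (_ : sigL _ _ = g) //; apply/funext => y.
by rewrite /sigL /= set_valE valKd.
Qed.

Lemma within_simplexwise (T Y : topologicalType) (A : set T) (h : T -> Y) :
  {within A, continuous h} -> simplexwise_continuous R A h.
Proof.
move=> /subspace_sigL_continuousP ch n u cu uA.
apply: (@cont_comp _ _ _
  (fun t => exist (fun x => x \in A) (u t) (mem_set (uA t)) : A) (sigL A h)) ch.
exact: continuous_comp_initial.
Qed.

Lemma unit_sphere_compact : compact (unit_sphere R d).
Proof.
apply: (@subclosed_compact _ _
  [set v : 'rV[R]_d.+1 | forall i, `[-1, 1]%classic (v ord0 i)]).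
- apply: (@preimage_closed _ _ (fun x : 'rV[R]_d.+1 => \sum_i x ord0 i ^+ 2) [set x | x = 1]).
    move=> x _; move: x; apply: cont_sum => i.
    by apply: contM => x; exact: coord_continuous.
  exact: closed_eq.
- have: ('I_d.+1 -> compact `[-1 : R, 1]) := fun=> @segment_compact R (-1) 1.
  exact: (@rV_compact R d.+1 (fun=> `[-1, 1]%classic)).
move=> x x1 i; rewrite /= in_itv /= -ler_norml -[leRHS]normr1 -ler_sqr ?nnegrE //.
rewrite !real_normK ?num_real // expr1n -x1 (bigD1 i) //= lerDl.
by apply: sumr_ge0 => j _; exact: sqr_ge0.
Qed.

Lemma realization_finite_faces : finite_faces K.
Proof.
have [f [g [cf fS fK gK cg]]] := sphere_chart.
apply: (@compact_finite_faces R); rewrite (_ : setT = g @` unit_sphere R d).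
  by apply: continuous_compact => //; exact: unit_sphere_compact.
by apply/seteqP; split=> // x _; exists (f x).
Qed.

Lemma vanish_realization m : (m <= d)%N -> vanish R m [set: X].
Proof.
move=> md; have [f [g [cf fS fK gK cg]]] := sphere_chart.
apply: (@vanish_retract R X _ setT (unit_sphere R d) f g) => //.
- by move=> n h ch _; exact: cont_comp ch cf.
- exact: within_simplexwise.
- by rewrite unit_sphereE; exact: vanish_sub_sphere.
Qed.

Lemma vanish_punctured_realization (b : X) m : vanish R m (~` [set b]).
Proof.
have [f [g [cf fS fK gK cg]]] := sphere_chart.
apply: (@vanish_retract R X _ _ (unit_sphere R d `&` ~` [set f b]) f g) => //.
- by move=> n h ch _; exact: cont_comp ch cf.
- by move=> x xb; split=> //= e; apply: xb; rewrite -[x]fK e fK.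
- by move=> n h ch hS; apply: (within_simplexwise cg) => // t; case: (hS t).
- by move=> y [yS yb] e; apply: yb; rewrite -e gK // inE.
by rewrite unit_sphereE; apply: vanish_punctured_sphere; rewrite -unit_sphereE.
Qed.

End SphereRealization.

Lemma seq_max (R : realDomainType) (T : eqType) (f : T -> R) (s : seq T) x :
  x \in s -> exists2 m, m \in s & {in s, forall y, f y <= f m}.
Proof.
elim: s x => // a s IHs _ _; case: s IHs => [_|b s IHs].
  by exists a; rewrite ?mem_head // => y; rewrite inE => /eqP->.
have [m ms mmax] := IHs b (mem_head b s).
have [fam|fma] := leP (f a) (f m).
  exists m; first by rewrite inE ms orbT.
  by move=> y; rewrite inE => /orP[/eqP->//|/mmax].
exists a; first exact: mem_head.
by move=> y; rewrite inE => /orP[/eqP->//|/mmax/le_trans->//]; exact: ltW.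
Qed.

(** * Retraction onto the subcomplex and count of degrees *)

Section Final.
Variables (R : realType) (d : nat) (V : choiceType) (K : simplicial_complex V).
Hypothesis sphereK : simplicial_sphere R d K.
Local Notation X := (realization R K).

Lemma vanish_nonmaximal_bigcap (W : {fset V}) m : (m + #|` W| <= d.+1)%N ->
  (m <= d)%N ->
  vanish R m [set x : X | {in W, forall w, nonmaximal [fset w]%fset x}].
Proof.
have finK := realization_finite_faces sphereK.
have [N KN] := finite_vertices finK.
move=> mW md; pose P (A : set X) := exists2 W : {fset V}, W != fset0 & A = nonmaximal W.
(* For empty [W] the intersection is the whole sphere, and the bound on the degree is [m <= d]. *)
case EW : (enum_fset W) => [|w0 l].
  rewrite (_ : mkset _ = setT); first exact: (vanish_realization sphereK md).
  apply/seteqP; split=> // x _ w wW.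
  by have : w \in enum_fset W by []; rewrite EW.
rewrite (_ : mkset _ =
    [set x | {in w0 :: l, forall w, nonmaximal [fset w]%fset x}]); last first.
  by rewrite -EW.
apply: (@vanish_bigcap R X P d) => //.
- by move=> A [U _ ->]; exact: nonmaximal_open.
- move=> A B [U U0 ->] [U' U'0 ->]; exists (U `|` U')%fset; last exact: nonmaximalU.
  by rewrite fsetU_eq0 negb_and U0.
- move=> A k [U U0 ->] kd; apply: (vanish_nonmaximal finK KN) => //.
    exact: (vanish_realization sphereK kd).
  by move=> x; exact: (vanish_punctured_realization sphereK).
- move=> w; exists [fset w]%fset => //; by apply/fset0Pn; exists w; rewrite inE.
by move: mW; rewrite -[#|` W|]/(size (enum_fset W)) EW addnS.
Qed.

Lemma acyclic_vanish (Y : topologicalType) (n : int) : vanish R 0 [set: Y] ->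
  (forall j : nat, j%:Z <= n -> vanish R j.+1 [set: Y]) -> acyclic R n Y.
Proof.
move=> v0 vn; split; first by have [x] := vanish0_neq0 v0; exists.
move=> j /vn vj c cyc; have [||b _ bc] := vj c; last by exists b.
  by move=> s _ t.
case: j c cyc {vj} => [|j] c //= cyc.
(* In degree 0 the boundary to the empty simplex is the sum of the coefficients. *)
have degE : forall b : achain R Y 1, bd b = deg b *: << tt : asimplex R Y 0 >>.
  move=> b; have : chain_on (fun=> True) b by [].
  move: b; apply: chain_ind => [|b b'|s _].
  - by rewrite raddf0 deg0 scale0r.
  - by rewrite raddfB /= degB scalerBl => -> ->.
  by rewrite bd1 degU scale1r /bd_simplex big_ord1 expr0 scale1r.
by rewrite degE cyc scale0r.
Qed.

Lemma vanish_avoiding (i : nat) (sigma : 'I_i -> {fset V}) m :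
  (m + \sum_(a < i) #|` sigma a| <= d.+1)%N -> (m <= d)%N ->
  vanish R m [set: realization R (avoiding K sigma)].
Proof.
move=> ms md; pose W := \big[@fsetU V/fset0]_(a < i) sigma a.
have cW : (#|` W| <= \sum_(a < i) #|` sigma a|)%N.
  rewrite /W; elim/big_ind2: _ => [|A a B b Aa Bb|//]; first by rewrite cardfs0.
  by rewrite (leq_trans _ (leq_add Aa Bb)) // cardfsU leq_subr.
have finK := realization_finite_faces sphereK.
have finA : finite_faces (avoiding K sigma).
  by have [D DK] := finK; exists D => s [/DK].
have [N KN] := finite_vertices finK.
set B := [set x : X | {in W, forall w, nonmaximal [fset w]%fset x}].
have vB k : (k + \sum_(a < i) #|` sigma a| <= d.+1)%N -> (k <= d)%N -> vanish R k B.
  move=> kd; apply: vanish_nonmaximal_bigcap.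
  by rewrite (leq_trans _ kd) // leq_add2l.
pose z (x : X) : {ptws V -> R} := fun v => if v \in W then 0 else bary x v.
pose y (x : X) : {ptws V -> R} := fun v => z x v / \sum_(u <- N) z x u.
have z0 x v : 0 <= z x v by rewrite /z; case: ifP => // _; exact: bary_ge0.
have zN x : B x -> \sum_(u <- N) z x u != 0.
  move=> xB.
  have [v vN v0] := bary_pos KN x.
  have [w wN wmax] := seq_max (bary x) vN.
  (* A coordinate that is maximal on [N] is maximal overall, so at a point of [B] it is not in [W]:
     it survives in [z] and makes the sum positive. *)
  have xu u : bary x u <= bary x w.
    have [/wmax//|uN] := boolP (u \in enum_fset N).
    have [s Ks [_ xs _]] := bary_closed_simplex x; rewrite xs ?bary_ge0 //.
    by apply: contra uN => /(fsubsetP (KN _ Ks)).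
  have zw : z x w = bary x w.
    rewrite /z; case: ifP => // /xB[w']; rewrite inE => /eqP-> [u].
    by rewrite ltNge xu.
  rewrite gt_eqF // (bigD1_seq w) //= ltr_pwDl ?sumr_ge0 // zw.
  exact: lt_le_trans v0 (xu v).
have yP x : B x -> exists2 s, avoiding K sigma s & closed_simplex R s (y x).
  move=> xB; have [s Ks [_ xs _]] := bary_closed_simplex x.
  have sW : closed_simplex R (s `\` W)%fset (y x).
    apply: closed_simplex_normalize => //.
    - by apply: fsubset_trans (KN _ Ks); exact: fsubsetDl.
    - move=> v; rewrite inE negb_and negbK /z; case: ifP => //= _; exact: xs.
    - exact: zN.
  exists (s `\` W)%fset => //; split; last first.
    move=> a; apply/fdisjointP => v; rewrite inE => /andP[vW _].
    apply: contra vW => va; apply/bigfcupP; exists a => //.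
    by rewrite mem_index_enum.
  apply: (face_sub Ks); first exact: fsubsetDl.
  apply/eqP => s0; move: sW; rewrite s0 => -[_ _]; rewrite big_nil => /eqP.
  by rewrite eq_sym oner_eq0.
(* A point of [B] provides the default value that [real_point] requires. *)
have [x0 x0B] : B !=set0.
  by apply: (@vanish0_neq0 R); apply: vB => //; rewrite (leq_trans _ ms) // leq_add2r.
have [s0 s0A s0y] := yP x0 x0B.
pose a0 : realization R (avoiding K sigma) :=
  @Realization R V (avoiding K sigma) (y x0) (ex_intro2 _ _ s0 s0A s0y).
have incl (x : realization R (avoiding K sigma)) :
    exists2 s, K s & closed_simplex R s (bary x).
  by have [s [Ks _] xs] := bary_closed_simplex x; exists s.
pose f (x : realization R (avoiding K sigma)) : X := Realization (incl x).
have xW (x : realization R (avoiding K sigma)) w : w \in W -> bary x w = 0.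
  move=> /bigfcupP[a _ wa]; have [s [_ sa] [_ xs _]] := bary_closed_simplex x.
  apply: xs; apply/negP => ws; have /fdisjointP/(_ _ ws) := sa a.
  by rewrite wa.
(* On the subcomplex the coordinates in [W] are zero, hence below any positive one. *)
have fB x : B (f x).
  move=> w wW; exists w; first by rewrite inE.
  have [u _ u0] := bary_pos KN (f x); exists u.
  by rewrite /= xW.
apply: (@vanish_retract R _ X setT B f (fun x => real_point a0 (y x))) => //.
- move=> n h ch _; apply: (realization_continuous finK) => v /=.
  apply: (cont_comp (g := fun x : realization R (avoiding K sigma) => bary x v) ch).
  exact: bary_continuous.
- move=> n h ch hB; apply: (realization_continuous finA) => v.
  rewrite (_ : (fun t => _) = fun t => y (h t) v); last first.
    by apply/funext => t; rewrite real_pointE //; exact: yP.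
  have cz u : continuous (fun t => z (h t) u).
    rewrite /z; case: (u \in W); first exact: cont_cst.
    by apply: (cont_comp (g := fun x : X => bary x u) ch); exact: bary_continuous.
  apply: contM => //; apply: contV; first exact: cont_sum.
  by move=> t; exact: zN.
- move=> x _; apply: realization_eq; rewrite real_pointE; last exact/yP/fB.
  have zE v : z (f x) v = bary x v by rewrite /z; case: ifP => // /xW.
  apply/funext => v; rewrite /y zE (eq_bigr _ (fun v _ => zE v)).
  by rewrite (bary_sum KN (f x)) divr1.
exact: vB.
Qed.


End Final.

Theorem proposition2p3 (R : realType) (d : nat) (V : choiceType)
    (K : simplicial_complex V) (k : nat) :
  simplicial_sphere R d K -> (1 <= k <= d.+1)%N ->
  complementary_acyclic R k (d%:Z - k%:Z) K.
Proof.
move=> sphereK /andP[k1 kd] i sigma ik Ksigma _ dimsum.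
set D := (\sum_(a < i) face_dim (sigma a))%N in dimsum *.
have cardE : (\sum_(a < i) #|` sigma a| = D + i)%N.
  rewrite (eq_bigr (fun a => face_dim (sigma a) + 1)%N) => [|a _].
    by rewrite big_split /= sum1_card card_ord.
  by rewrite /face_dim addn1 prednK // cardfs_gt0 (face_neq0 (Ksigma a)).
(* As [i <= k], this bound gives [m + D + i <= d.+1]; as [1 <= k], it also gives [m <= d]. *)
have vanishP m : (m + D <= d.+1 - k)%N ->
    vanish R m [set: realization R (avoiding K sigma)].
  move=> mD; apply: (vanish_avoiding sphereK); last by lia.
  by rewrite cardE; lia.
(* Nonemptiness is [m = 0], where the bound is [dimsum]; degree [j] is [m = j.+1]. *)
by apply: acyclic_vanish => [|j jn]; apply: vanishP; lia.
Qed.
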